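(* For all $p\in\mathbb{C}$ with $0<|p|$ sufficiently small, \[3\,g(p)=n\!\left(\frac{27p}{(1+4p)^3}\right)+4\,n\!\left(\frac{27p^2}{(1-2p)^3}\right).\] Furthermore, for all $u\in\mathbb{C}$ with $0<|u|$ sufficiently small, \[3\,n\!\left(\frac{27u(1+u)^4}{2(1+4u+u^2)^3}\right)=g\!\left(\frac{u}{2(1+u)^2}\right)-8\,g\!\left(-\frac{u(1+u)}{2}\right)+4\,g\!\left(\frac{u^2}{4(1+u)}\right).\]
   Context: $\mathrm{m}$ is the logarithmic Mahler measure $\mathrm{m}(P)=\int_0^1\int_0^1\log|P(e^{2\pi i\theta_1},e^{2\pi i\theta_2})|d\theta_1d\theta_2$; $n(t)=\mathrm{m}\!\left(x^3+y^3+1-\frac{3}{t^{1/3}}xy\right)$ and $g(t)=\mathrm{m}\!\left((x+y)(x+1)(y+1)-\frac1t xy\right)$. *)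

(* Defs.v *)
From HB Require Import structures.
From mathcomp Require Import all_boot all_order all_algebra.
From mathcomp Require Import all_classical all_reals all_analysis.
From mathcomp Require Import complex.
Set Implicit Arguments. Unset Strict Implicit. Unset Printing Implicit Defensive.
Import Order.TTheory GRing.Theory Num.Theory.
Local Open Scope ring_scope.
Local Open Scope classical_set_scope.

Section Mahler.
Variable R : realType.
Local Notation C := R[i].

Definition unit_circ (theta : R) : C :=
  Complex (cos (2 * pi * theta)) (sin (2 * pi * theta)).

Definition mahler (P : C -> C -> C) : \bar R :=
  (\int[lebesgue_measure]_(t1 in `[0%R, 1%R])
     \int[lebesgue_measure]_(t2 in `[0%R, 1%R])
        (ln (ComplexField.Normc.normc (P (unit_circ t1) (unit_circ t2))))%:E)%E.

(* n(t) = m(x^3 + y^3 + 1 - 3 t^{-1/3} x y); 3.-root is a fixed choice of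
   cube root (the Mahler measure does not depend on the choice). *)
Definition n_fun (t : C) : \bar R :=
  mahler (fun x y => x ^+ 3 + y ^+ 3 + 1 - 3 / (3.-root t) * x * y).

Definition g_fun (t : C) : \bar R :=
  mahler (fun x y => (x + y) * (x + 1) * (y + 1) - t^-1 * x * y).

End Mahler.
Arguments n_fun {R} t%_ring_scope.
Arguments g_fun {R} t%_ring_scope.

(* Main.v *)
(* Write a_j = (3j)!/j!^3 and let b_m be the Franel numbers, the sum over k of C(m,k)^3.  Taking constant
   terms of powers of the two Laurent polynomials on the torus gives, for small arguments,
     g(p) = - log|p| - Re sum_m b_m p^m / m,   3 n(27 T) = - log|T| - Re sum_j a_j T^j / j.
   Put F(p) = sum_m b_m p^m and A(T) = sum_j a_j T^j.  Two evaluations of b_m, one from MacMahon's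
   formula for sums of cubes of binomials and one by creative telescoping, say that
     F(p) = A(p^2 / (1 - 2p)^3) / (1 - 2p) = A(p / (1 + 4p)^3) / (1 + 4p).
   Applying the Euler operator to either functional equation turns it into a linear relation between
   values of F and A with rational coefficients, and these two formulas reduce all of the values
   to a single one; what is left is a rational function identity.

   No infinite series is used: for every M the truncations at order M satisfy each of these relations
   up to O(2^-M), and M is arbitrary in the end.  The Euler operator is applied along the segment
   s |-> s u, 0 <= s <= 1, and errors of size O(s) for it integrate to errors for the functions. *)
Require Import Defs.
From HB Require Import structures.
From mathcomp Require Import all_boot all_order all_algebra.
From mathcomp Require Import all_classical all_reals all_analysis.
From mathcomp Require Import measurable_realfun complex.
From mathcomp Require Import zify ring lra.
Set Implicit Arguments. Unset Strict Implicit. Unset Printing Implicit Defensive.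
Import Order.TTheory GRing.Theory Num.Theory.
Import numFieldNormedType.Exports.

(** * Franel numbers *)

(** The Euler operator is effective because logarithmic derivatives of the arguments have the
    denominators that occur as prefactors in the functional equations. At T1 = p/(1+4p)^3 and T2 =
    p^2/(1-2p)^3 they are (1-8p)/(1+4p) and 2(1+p)/(1-2p); multiplied by A(T1) and A(T2) they become
    polynomial multiples of F(p), and the first identity comes down to (1-8p) + 8(1+p) = 9. In the
    second identity the three arguments of g all lead to one value A(V), while the argument of n is
    tied to the first of them by the cubic substitution.

    The logarithms of the arguments combine so that log|p| or log|u| cancels. What is compared along
    the segment is therefore regular at s = 0 and vanishes there, which leaves no constant of
    integration.

    Recovering a derivative from the Euler operator means dividing by s. A truncation error that is
    merely small would not survive this, so every error estimate for the truncated functional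
    equations carries a factor |v| besides 2^-M. *)

Lemma mul_bin_sub x y m : m <= y -> 'C(x, y) * 'C(y, m) = 'C(x, m) * 'C(x - m, y - m).
Proof.
move=> my; have [yx|xy] := leqP y x; last first.
  rewrite bin_small // mul0n; have [mx|?] := leqP m x; last by rewrite bin_small.
  by rewrite [X in _ = _ * X]bin_small ?muln0 //; lia.
have mx := leq_trans my yx.
have pos : 0 < m`! * (y - m)`! * (x - y)`! by rewrite !muln_gt0 !fact_gt0.
apply/eqP; rewrite -(eqn_pmul2r pos); apply/eqP.
have e1 := bin_fact yx; have e2 := bin_fact my; have e3 := bin_fact mx.
have e4 : 'C(x - m, y - m) * ((y - m)`! * (x - y)`!) = (x - m)`!.
  by rewrite -(bin_fact (n := x - m) (m := y - m)) ?leq_sub2r // subnBA // subnK.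
transitivity x`!.
  by rewrite -e1 -e2; ring.
by rewrite -e3 -e4; ring.
Qed.

Lemma mul_bin_compl m j i : j <= m -> i <= m -> 'C(m, j) * 'C(j, i) = 'C(m, i) * 'C(m - i, m - j).
Proof.
move=> jm im; have [ij|ji] := leqP i j; last first.
  by rewrite [X in _ * X]bin_small // [X in _ = _ * X]bin_small ?muln0 //; lia.
rewrite mul_bin_sub // -[X in _ * X = _]bin_sub; last lia.
by congr (_ * 'C(_, _)); lia.
Qed.

(** Vandermonde's convolution expands C(x+j, m+l) in the C(j,i); the sum over j is again a
    convolution, with value C(m+l-i, m). Trinomial revision of C(x, m+l-i) C(m+l-i, m) then leaves a
    last convolution in i. *)
Lemma suranyi x m l :
  \sum_(j < m.+1) 'C(m, j) * 'C(l, j) * 'C(x + j, m + l) = 'C(x, m) * 'C(x, l).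
Proof.
transitivity (\sum_(i < (m + l).+1) 'C(x, m + l - i) * ('C(m, i) * 'C(m + l - i, m))).
  under eq_bigr => j _ do rewrite addnC -binomial.Vandermonde big_distrr /=.
  rewrite exchange_big /=; apply: eq_bigr => i _.
  have [im|mi] := leqP i m; last first.
    rewrite [X in _ = _ * (X * _)]bin_small // mul0n muln0 big1 // => j _.
    by rewrite [X in _ * (X * _)]bin_small ?mul0n ?muln0 //; have := ltn_ord j; lia.
  have -> : m + l - i = l + (m - i) by lia.
  rewrite -binomial.Vandermonde !big_distrr /=; apply: eq_bigr => j _.
  have jm : j <= m by rewrite -ltnS.
  have := mul_bin_compl jm im; move: 'C(x, _) => c e.
  transitivity (('C(m, j) * 'C(j, i)) * 'C(l, j) * c); first by ring.
  by rewrite e; ring.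
have [mx|xm] := leqP m x; last first.
  rewrite [X in _ = X * _]bin_small // mul0n big1 // => i _.
  have [h|h] := leqP m (m + l - i).
    by rewrite [X in X * _]bin_small ?mul0n //; lia.
  by rewrite [X in _ * (_ * X)]bin_small ?muln0.
rewrite -[X in _ = _ * 'C(X, l)](subnKC mx) -binomial.Vandermonde big_distrr /=.
rewrite -(big_mkord xpredT (fun i => 'C(x, m + l - i) * ('C(m, i) * 'C(m + l - i, m)))).
rewrite -(big_mkord xpredT (fun i => 'C(x, m) * ('C(m, i) * 'C(x - m, l - i)))).
(* For i > l the factor C(m+l-i, m) vanishes, and the truncated difference l - i would be misleading
   there. *)
rewrite (big_cat_nat _ (n := l.+1)) //=; last by lia.
rewrite [X in _ + X]big_nat_cond [X in _ + X]big1 ?addn0; last first.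
  by move=> i hi; rewrite [X in _ * (_ * X)]bin_small ?muln0 //; lia.
rewrite [LHS]big_nat_cond [RHS]big_nat_cond; apply: eq_bigr => i; rewrite andbT => hi.
have e : 'C(x, m + l - i) * 'C(m + l - i, m) = 'C(x, m) * 'C(x - m, l - i).
  by rewrite mul_bin_sub; [congr (_ * 'C(_, _)); lia | lia].
by rewrite mulnCA e mulnCA.
Qed.

Definition franel n : nat := \sum_(k < n.+1) 'C(n, k) ^ 3.
Definition trinom j : nat := 'C(3 * j, j) * 'C(2 * j, j).

Lemma trinom_fact j : trinom j * j`! ^ 3 = (3 * j)`!.
Proof.
have e1 : 'C(3 * j, j) * (j`! * (2 * j)`!) = (3 * j)`!.
  by rewrite -(bin_fact (n := 3 * j) (m := j)) ?leq_pmull //; congr (_ * (_ * _`!)); lia.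
have e2 : 'C(2 * j, j) * (j`! * j`!) = (2 * j)`!.
  by rewrite -(bin_fact (n := 2 * j) (m := j)) ?leq_pmull //; congr (_ * (_ * _`!)); lia.
by rewrite -e1 -e2 /trinom; ring.
Qed.

Lemma bin_le_exp2 n k : 'C(n, k) <= 2 ^ n.
Proof.
have [kn|nk] := leqP k n; last by rewrite bin_small.
have := expnDn 1 1 n; rewrite addn1 => ->.
rewrite (bigD1 (Ordinal (n := n.+1) (m := k) kn)) //= !exp1n !muln1; exact: leq_addr.
Qed.

Lemma trinom_le j : trinom j <= 32 ^ j.
Proof.
rewrite (_ : 32 = 2 ^ 3 * 2 ^ 2) // expnMn -!expnM.
by apply: leq_mul; apply: bin_le_exp2.
Qed.

(** The sum over k counts splittings of an n-set into two blocks with a marked j-subset in each.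
    Choosing the marked subsets first gives C(n,j) C(n-j,j), and each remaining element goes to
    either block, whence the power of 2. *)
Lemma sum_fact_bin n j : 2 * j <= n ->
  \sum_(k < n.+1) 'C(n, k) * ('C(k, j) * 'C(n - k, j)) * 'C(n + j, n)
   = trinom j * 'C(n + j, 3 * j) * 2 ^ (n - 2 * j).
Proof.
move=> jn; rewrite -big_distrl /=.
have key k : k <= n -> 'C(n, k) * ('C(k, j) * 'C(n - k, j)) = 'C(n, j) * 'C(n - j, j) * (if j <= k then 'C(n - 2 * j, k - j) else 0).
  move=> kn; case: ifPn => [jk|]; last by rewrite -ltnNge => kj; rewrite [X in _ * (X * _)]bin_small // !muln0.
  rewrite mulnA mul_bin_sub // -mulnA -mulnA; congr (_ * _).
  have -> : 'C(n - j, k - j) = 'C(n - j, n - k) by rewrite -bin_sub; [congr 'C(_, _); lia | lia].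
  have [h|h] := leqP j (n - k); last first.
    by rewrite [X in _ * X]bin_small // [X in _ = _ * X]bin_small ?muln0 //; lia.
  rewrite mul_bin_sub //; congr (_ * _).
  have -> : n - j - j = n - 2 * j by lia.
  by rewrite -bin_sub; [congr 'C(_, _); lia | lia].
rewrite (eq_bigr (fun k : 'I_n.+1 => 'C(n, j) * 'C(n - j, j) *
    (if j <= k then 'C(n - 2 * j, k - j) else 0))); last first.
  by move=> k _; apply: key; rewrite -ltnS.
rewrite -big_distrr /= -(big_mkord xpredT (fun k => if j <= k then 'C(n - 2 * j, k - j) else 0)).
rewrite (big_cat_nat (n := j)) //=; last by lia.
rewrite [X in X + _]big_nat_cond big1 ?add0n; last by move=> k; case: leqP => //; lia.
rewrite -[X in \sum_(X <= _ < _) _]add0n big_addn.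
under eq_bigr => i _ do rewrite addnK leq_addl.
have -> : \sum_(0 <= i < n.+1 - j) 'C(n - 2 * j, i) = 2 ^ (n - 2 * j).
  rewrite (big_cat_nat (n := (n - 2 * j).+1)) //=; last by lia.
  rewrite [X in _ + X]big_nat_cond [X in _ + X]big1 ?addn0; last by move=> i hi; rewrite bin_small //; lia.
  by rewrite big_mkord -[2 in RHS]/(1 + 1) expnDn; apply: eq_bigr => i _; rewrite !exp1n !muln1.
rewrite mulnAC; congr (_ * _).
have pos : 0 < j`! ^ 3 * (n - 2 * j)`! by rewrite muln_gt0 expn_gt0 !fact_gt0.
apply/eqP; rewrite -(eqn_pmul2r pos); apply/eqP.
have e1 : 'C(n, j) * (j`! * (n - j)`!) = n`! by apply: bin_fact; lia.
have e2 : 'C(n - j, j) * (j`! * (n - 2 * j)`!) = (n - j)`!.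
  by rewrite -(bin_fact (n := n - j) (m := j)); [congr (_ * (_ * _`!)); lia|lia].
have e3 : 'C(n + j, n) * (n`! * j`!) = (n + j)`!.
  by rewrite -(bin_fact (n := n + j) (m := n)); [congr (_ * (_ * _`!)); lia|lia].
have e4 : 'C(n + j, 3 * j) * ((3 * j)`! * (n - 2 * j)`!) = (n + j)`!.
  by rewrite -(bin_fact (n := n + j) (m := 3 * j)); [congr (_ * (_ * _`!)); lia|lia].
transitivity (n + j)`!.
  by rewrite -e3 -e1 -e2; ring.
by rewrite -e4 -trinom_fact; ring.
Qed.

(** MacMahon's formula: [suranyi] at x = n, m = k, l = n - k expands two of the three factors
    C(n,k), and [sum_fact_bin] carries out the sum over k. *)
Lemma franel_macmahon n :
  franel n = \sum_(j < n.+1 | 2 * j <= n) trinom j * 'C(n + j, 3 * j) * 2 ^ (n - 2 * j).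
Proof.
under eq_bigr => j h do rewrite -sum_fact_bin //.
rewrite exchange_big /=; apply: eq_bigr => k _.
have kn : k <= n by rewrite -ltnS.
have := suranyi n k (n - k); rewrite subnKC // bin_sub // => e.
rewrite expnS -mulnn -e.
transitivity (\sum_(j < n.+1) 'C(n, k) * ('C(k, j) * 'C(n - k, j) * 'C(n + j, n))).
  rewrite -big_distrr /=; congr (_ * _).
  rewrite -(big_mkord xpredT (fun j => 'C(k, j) * 'C(n - k, j) * 'C(n + j, n))).
  rewrite -(big_mkord xpredT (fun j => 'C(k, j) * 'C(n - k, j) * 'C(n + j, n))).
  rewrite [RHS](big_cat_nat (n := k.+1)) //= [X in _ = _ + X]big_nat_cond [X in _ = _ + X]big1 ?addn0 //.
  by move=> j hj; rewrite [X in X * _ * _]bin_small //; lia.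
rewrite [LHS](bigID (fun j : 'I_n.+1 => 2 * j <= n)) /= [X in _ + X]big1 ?addn0.
  by apply: eq_bigr => j _; rewrite !mulnA.
move=> j hj; have [h|h] := leqP j k.
  by rewrite [X in _ * (_ * X * _)]bin_small ?muln0 //; lia.
by rewrite [X in _ * (X * _ * _)]bin_small ?muln0.
Qed.

(** * The second formula for the Franel numbers, by creative telescoping *)

Section FranelCubic.
Variable F : numFieldType.
Local Open Scope ring_scope.
Implicit Types n j k : nat.

(** The reciprocal of (n-k)!, extended by zero as 1/Gamma is. With this extension [rfactS] holds for
    all n and k, so the telescoping identities have no boundary cases. *)
Definition rfact n k : F := if (k <= n)%N then ((n - k)`!%:R)^-1 else 0.

Lemma rfactS n k : (n.+1%:R - k%:R) * rfact n.+1 k = rfact n k.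
Proof.
rewrite /rfact; have [kn|nk] := leqP k n.
  rewrite leqW // subSn // factS natrM -natrB ?leqW // subSn //.
  by rewrite invfM mulrA divff ?mul1r // pnatr_eq0.
have [k1|_] := leqP k n.+1; last by rewrite mulr0.
by rewrite (_ : k = n.+1) ?subrr ?mul0r //; apply/eqP; rewrite eqn_leq k1.
Qed.

Lemma rfactSS n k : rfact n.+1 k.+1 = rfact n k.
Proof. by rewrite /rfact ltnS subSS. Qed.

Lemma rfact_gt n k : (n < k)%N -> rfact n k = 0.
Proof. by rewrite /rfact ltnNge => /negbTE ->. Qed.

(** Franel's three-term recurrence. It is verified for both sums and compares them; one of them is
    already known to be b_n. *)
Definition franel_rec (s : nat -> F) := forall n,
  n.+2%:R ^+ 2 * s n.+2 =
  (7 * n.+1%:R ^+ 2 + 7 * n.+1%:R + 2) * s n.+1 + 8 * n.+1%:R ^+ 2 * s n.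

Lemma franel_rec_uniq s1 s2 : franel_rec s1 -> franel_rec s2 ->
  s1 0 = s2 0 -> s1 1 = s2 1 -> s1 =1 s2.
Proof.
move=> r1 r2 e0 e1 n.
suff [] : s1 n = s2 n /\ s1 n.+1 = s2 n.+1 by [].
elim: n => [//|n [a b]]; split=> //.
have nz : n.+2%:R ^+ 2 != 0 :> F by rewrite expf_neq0 // pnatr_eq0.
by apply: (mulfI nz); rewrite r1 r2 a b.
Qed.

(** Summands in hypergeometric form: factorials replace binomials and the powers are split as 2^n /
    4^j and (-4)^n / (-4)^j, so that a shift of n or j multiplies each factor by a rational
    function. [mm_termE] and [cubic_termE] lead back to binomials. *)
Definition mm_term n j : F := (n + j)`!%:R / j`!%:R ^+ 3 * rfact n (2 * j) * 2 ^+ n / 4 ^+ j.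
Definition cubic_term n j : F :=
  (n + 2 * j)`!%:R / j`!%:R ^+ 3 * rfact n j * (-4) ^+ n / (-4) ^+ j.

(* Wilf-Zeilberger certificates: the Franel recurrence operator applied to a term in n is the
   difference in j of its certificate. *)
Definition mm_cert n j : F :=
  - 24 * (3 * n.+1%:R + 1) * j%:R ^+ 3
  * ((n + j)`!%:R / j`!%:R ^+ 3 * rfact n.+2 (2 * j) * 2 ^+ n / 4 ^+ j).
Definition cubic_cert n j : F :=
  - 48 * (3 * n.+1%:R + 2) * j%:R ^+ 3
  * ((n + 2 * j)`!%:R / j`!%:R ^+ 3 * rfact n.+2 j * (-4) ^+ n / (-4) ^+ j).

Lemma mm_telescope n j :
  n.+2%:R ^+ 2 * mm_term n.+2 j
  - (7 * n.+1%:R ^+ 2 + 7 * n.+1%:R + 2) * mm_term n.+1 j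
  - 8 * n.+1%:R ^+ 2 * mm_term n j = mm_cert n j.+1 - mm_cert n j.
Proof.
rewrite /mm_cert /mm_term (_ : 2 * j.+1 = (2 * j).+2)%N; last by rewrite mulnS.
(* Every reciprocal factorial is a polynomial multiple of [rfact n.+2 (2 * j)], so only a rational
   function identity is left. *)
rewrite !rfactSS -(rfactS n) -(rfactS n.+1) !addSn !addnS !factS !exprS !natrM.
set r := rfact _ _; set f := (n + j)`!%:R; set g := j`!%:R : F.
have g0 : g != 0 by rewrite pnatr_eq0 -lt0n fact_gt0.
have j0 : j.+1%:R != 0 :> F by rewrite pnatr_eq0.
have q0 : 4 ^+ j != 0 :> F by rewrite expf_neq0 // pnatr_eq0.
move: r f g g0 (4 ^+ j) q0 (2 ^+ n) j0 => r f g g0 q q0 h; rewrite -![_.+2%:R]natr1 -![_.+1%:R]natr1 !natrD ?natrM => j0.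
by field; apply/and3P; split.
Qed.

Lemma cubic_telescope n j :
  n.+2%:R ^+ 2 * cubic_term n.+2 j
  - (7 * n.+1%:R ^+ 2 + 7 * n.+1%:R + 2) * cubic_term n.+1 j
  - 8 * n.+1%:R ^+ 2 * cubic_term n j = cubic_cert n j.+1 - cubic_cert n j.
Proof.
rewrite /cubic_cert /cubic_term (_ : n + 2 * j.+1 = (n + 2 * j).+2)%N; last by rewrite mulnS !addnS.
rewrite !rfactSS -(rfactS n) -(rfactS n.+1) !addSn !factS !exprS !natrM.
set r := rfact _ _; set f := (n + 2 * j)`!%:R; set g := j`!%:R : F.
have g0 : g != 0 by rewrite pnatr_eq0 -lt0n fact_gt0.
have j0 : j.+1%:R != 0 :> F by rewrite pnatr_eq0.
have q0 : (-4) ^+ j != 0 :> F by rewrite expf_neq0 // oppr_eq0 pnatr_eq0.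
move: r f g g0 ((-4) ^+ j) q0 ((-4) ^+ n) j0 => r f g g0 q q0 h; rewrite -![_.+2%:R]natr1 -![_.+1%:R]natr1 !natrD ?natrM => j0.
by field; apply/and3P; split.
Qed.

(** Summed over 0 <= j < n+3, the certificate telescopes to its two end values, which are both
    zero. *)
Lemma franel_rec_telescope (t c : nat -> nat -> F) :
  (forall n j, n.+2%:R ^+ 2 * t n.+2 j - (7 * n.+1%:R ^+ 2 + 7 * n.+1%:R + 2) * t n.+1 j
     - 8 * n.+1%:R ^+ 2 * t n j = c n j.+1 - c n j) ->
  (forall n, c n 0 = 0) -> (forall n, c n n.+3 = 0) ->
  (forall n j, (n < j)%N -> t n j = 0) ->
  franel_rec (fun n => \sum_(j < n.+1) t n j).
Proof.
move=> tc c0 c1 t0 n.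
(* The three sums have different lengths; terms beyond the diagonal vanish, so all can be taken over
   the longest range. *)
have ext m : (m <= n.+2)%N -> \sum_(j < m.+1) t m j = \sum_(0 <= j < n.+3) t m j.
  move=> mn; rewrite (big_cat_nat (n := m.+1)) //= big_mkord.
  rewrite [X in _ = _ + X]big_nat_cond [X in _ = _ + X]big1 ?addr0 // => j /andP[/andP[h _] _].
  exact: t0.
rewrite !ext //; last by rewrite ltnW.
have := telescope_sumr (c n) (leq0n n.+3).
under eq_bigr => j _ do rewrite -tc.
rewrite c0 c1 subr0 !sumrB -!mulr_sumr => e.
by apply/eqP; rewrite -subr_eq0 opprD addrA e.
Qed.

Lemma rfact_eq n k : (k <= n)%N -> rfact n k = ((n - k)`!%:R)^-1.
Proof. by rewrite /rfact => ->. Qed.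

Lemma fact_neq0 n : n`!%:R != 0 :> F.
Proof. by rewrite pnatr_eq0 -lt0n fact_gt0. Qed.

Lemma term_bin i j : (3 * j <= i)%N ->
  i`!%:R / j`!%:R ^+ 3 / (i - 3 * j)`!%:R = (trinom j)%:R * 'C(i, 3 * j)%:R :> F.
Proof.
move=> ji.
have e := bin_fact ji; rewrite -trinom_fact in e.
rewrite -e !natrM; field.
by rewrite !fact_neq0.
Qed.

Lemma mm_termE n j : (2 * j <= n)%N ->
  mm_term n j = (trinom j)%:R * 'C(n + j, 3 * j)%:R * 2 ^+ (n - 2 * j).
Proof.
move=> jn; rewrite /mm_term rfact_eq // -term_bin; last by lia.
have -> : (n + j - 3 * j = n - 2 * j)%N by lia.
have q0 : 4 ^+ j != 0 :> F by rewrite expf_neq0 // pnatr_eq0.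
have -> : 2 ^+ n = 2 ^+ (n - 2 * j) * 4 ^+ j :> F.
  by rewrite (_ : 4 = 2 ^+ 2); [rewrite -exprM -exprD subnK | ring].
by move: (4 ^+ j) q0 => q q0; field; rewrite !fact_neq0 q0.
Qed.

Lemma cubic_termE n j : (j <= n)%N ->
  cubic_term n j = (trinom j)%:R * 'C(n + 2 * j, 3 * j)%:R * (-4) ^+ (n - j).
Proof.
move=> jn; rewrite /cubic_term rfact_eq // -term_bin; last by lia.
have -> : (n + 2 * j - 3 * j = n - j)%N by lia.
rewrite -[X in _ * X / _](_ : (-4) ^+ (n - j) * (-4) ^+ j = _); last by rewrite -exprD subnK.
have : (-4) ^+ j != 0 :> F by rewrite expf_neq0 // oppr_eq0 pnatr_eq0.
by move: ((-4) ^+ j) => q q0; field; rewrite !fact_neq0 q0.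
Qed.

Lemma franel_mm n : (franel n)%:R = \sum_(j < n.+1) mm_term n j.
Proof.
rewrite franel_macmahon natr_sum [RHS](bigID (fun j : 'I_n.+1 => 2 * j <= n)%N) /=.
rewrite [X in _ + X]big1 ?addr0.
  by apply: eq_bigr => j h; rewrite mm_termE // !natrM natrX.
by move=> j; rewrite -ltnNge => h; rewrite /mm_term rfact_gt // mulr0 !mul0r.
Qed.

Lemma franel_quadratic n : (franel n)%:R =
  \sum_(j < n.+1 | (2 * j <= n)%N) (trinom j)%:R * 'C(n + j, 3 * j)%:R * 2 ^+ (n - 2 * j) :> F.
Proof.
by rewrite franel_macmahon natr_sum; apply: eq_bigr => j h; rewrite !natrM natrX.
Qed.

(** Both sums obey the recurrence and start with the values 1 and 2, hence they agree. *)
Lemma franel_cubic n : (franel n)%:R =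
  \sum_(j < n.+1) (trinom j)%:R * 'C(n + 2 * j, 3 * j)%:R * (-4) ^+ (n - j) :> F.
Proof.
rewrite franel_mm; transitivity (\sum_(j < n.+1) cubic_term n j); last first.
  by apply: eq_bigr => j _; rewrite cubic_termE // -ltnS.
move: n; apply: franel_rec_uniq.
- apply: (franel_rec_telescope mm_telescope) => [n|n|n j h].
  + by rewrite /mm_cert expr0n mulr0 mul0r.
  + by rewrite /mm_cert rfact_gt ?(mulr0, mul0r) //; lia.
  + by rewrite /mm_term rfact_gt ?(mulr0, mul0r) //; lia.
- apply: (franel_rec_telescope cubic_telescope) => [n|n|n j h].
  + by rewrite /cubic_cert expr0n mulr0 mul0r.
  + by rewrite /cubic_cert rfact_gt ?(mulr0, mul0r) //; lia.
  + by rewrite /cubic_term rfact_gt ?(mulr0, mul0r) //; lia.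
- by rewrite !big_ord1 mm_termE // cubic_termE // !muln0 !expr0.
- rewrite !big_ord_recl !big_ord0 /= !cubic_termE // mm_termE //.
  rewrite /mm_term rfact_gt // /bump /=.
  rewrite (_ : trinom 0 = 1)%N // (_ : trinom 1 = 6)%N // !bin0 ?binn.
  by rewrite /= expr1; ring.
Qed.

End FranelCubic.

Local Open Scope ring_scope.

(** * Differentiation along a segment *)

Section ComplexModulus.
Variable R : realType.
Local Notation C := R[i].
Local Notation cre := (@complex.Re R).
Implicit Types (z w : C) (x : R).

Definition cabs z : R := ComplexField.Normc.normc z.

Lemma cabs_ge0 z : 0 <= cabs z. Proof. by case: z => a b; rewrite sqrtr_ge0. Qed.
Lemma cabs0 : cabs 0 = 0. Proof. exact: ComplexField.Normc.normc0. Qed.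
Lemma cabs1 : cabs 1 = 1. Proof. exact: ComplexField.Normc.normc1. Qed.
Lemma cabsM z w : cabs (z * w) = cabs z * cabs w.
Proof. exact: ComplexField.Normc.normcM. Qed.
Lemma cabsM_le z w x y : cabs z <= x -> cabs w <= y -> cabs (z * w) <= x * y.
Proof. by move=> ? ?; rewrite cabsM ler_pM ?cabs_ge0. Qed.
Lemma cabsV z : cabs z^-1 = (cabs z)^-1. Proof. exact: ComplexField.Normc.normcV. Qed.
Lemma cabsf z w : cabs (z / w) = cabs z / cabs w. Proof. by rewrite cabsM cabsV. Qed.
Lemma cabsN z : cabs (- z) = cabs z. Proof. exact: normcN. Qed.
Lemma cabsD z w : cabs (z + w) <= cabs z + cabs w. Proof. exact: le_normcD. Qed.
Lemma cabsB z w : cabs (z - w) <= cabs z + cabs w.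
Proof. by rewrite -(cabsN w) cabsD. Qed.
Lemma cabsX z n : cabs (z ^+ n) = cabs z ^+ n.
Proof. by elim: n => [|n IH]; rewrite ?expr0 ?cabs1 // !exprS cabsM IH. Qed.
Lemma cabs_real x : cabs x%:C%C = `|x|.
Proof. by rewrite /cabs /= expr0n /= addr0 sqrtr_sqr. Qed.
Lemma cabs_nat n : cabs n%:R = n%:R.
Proof. by rewrite -(rmorph_nat (real_complex R)) cabs_real normr_nat. Qed.
Lemma cabs_eq0 z : (cabs z == 0) = (z == 0).
Proof.
apply/eqP/eqP => [|->]; [exact: ComplexField.Normc.eq0_normc | exact: cabs0].
Qed.
Lemma cabs_gt0 z : (0 < cabs z) = (z != 0).
Proof. by rewrite lt_def cabs_ge0 andbT cabs_eq0. Qed.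
Lemma cabs_sub_ge z w : cabs z - cabs w <= cabs (z - w).
Proof. by rewrite lerBlDr -{1}(subrK w z) cabsD. Qed.
Lemma cabs_sum I (r : seq I) (P : pred I) (F : I -> C) :
  cabs (\sum_(i <- r | P i) F i) <= \sum_(i <- r | P i) cabs (F i).
Proof.
elim/big_ind2: _ => [|z x w y zx wy|//]; first by rewrite cabs0.
exact: le_trans (cabsD _ _) (lerD zx wy).
Qed.

Lemma cre_abs z : `|cre z| <= cabs z.
Proof.
case: z => a b; rewrite /cabs /= -sqrtr_sqr ler_wsqrtr // lerDl sqr_ge0 //.
Qed.
Lemma cre_le z : cre z <= cabs z. Proof. exact: le_trans (ler_norm _) (cre_abs z). Qed.
Lemma creD z w : cre (z + w) = cre z + cre w. Proof. by case: z; case: w. Qed.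
Lemma creN z : cre (- z) = - cre z. Proof. by case: z. Qed.
Lemma creB z w : cre (z - w) = cre z - cre w. Proof. by case: z; case: w. Qed.
Lemma creMr x z : cre (x%:C%C * z) = x * cre z.
Proof. by case: z => a b /=; rewrite mul0r subr0. Qed.
Lemma cre_sum I (r : seq I) (P : pred I) (F : I -> C) :
  cre (\sum_(i <- r | P i) F i) = \sum_(i <- r | P i) cre (F i).
Proof. by elim/big_rec2: _ => // i x z _ <-; rewrite creD. Qed.
Lemma creMnat n z : cre (n%:R * z) = n%:R * cre z.
Proof. by rewrite -(rmorph_nat (real_complex R)) creMr. Qed.

Lemma cabs1D_sqr z : cabs (1 + z) ^+ 2 = 1 + (2 * cre z + cabs z ^+ 2).
Proof.
case: z => a b; rewrite /cabs /= !sqr_sqrtr ?addr_ge0 ?sqr_ge0 //; ring.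
Qed.

(** With t = (w-z)/z this is 2 ln|1+t| = ln(1 + 2 Re t + |t|^2) <= 2 Re t + |t|^2. Only an upper
    bound is needed: exchanging z and w provides the lower one. *)
Lemma ln_cabs_sub_le z w : z != 0 -> w != 0 ->
  ln (cabs w) - ln (cabs z) <= cre ((w - z) / z) + cabs ((w - z) / z) ^+ 2.
Proof.
move=> z0 w0; set t := (w - z) / z.
have wz : w / z = 1 + t by rewrite /t mulrBl divff //; ring.
have t0 : 0 < cabs (1 + t) by rewrite cabs_gt0 -wz mulf_neq0 ?invr_neq0.
rewrite -ln_div ?posrE ?cabs_gt0 // -cabsf wz.
have : ln (cabs (1 + t) ^+ 2) <= 2 * cre t + cabs t ^+ 2.
  rewrite cabs1D_sqr; apply: le_ln1Dx.
  by rewrite -subr_gt0 opprK addrC -cabs1D_sqr exprn_gt0.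
rewrite lnXn // mulr2n; have := sqr_ge0 (cabs t); lra.
Qed.

End ComplexModulus.

(** * Uniform differentiability on the unit segment and the Euler operator *)

Section PathCalculus.
Variable R : realType.
Local Notation C := R[i].
Local Notation cre := (@complex.Re R).
Local Notation "x %:C" := (real_complex R x) (format "x %:C") : ring_scope.
Implicit Types (f g : R -> C) (phi psi : R -> R) (s t : R).

(* Differentiability with a uniform quadratic remainder: it passes to products, inverses and
   logarithms by plain estimates, and a vanishing derivative forces constancy by telescoping. *)
Definition cderiv f f' := exists2 M : R, 0 <= M & forall s t, 0 <= s <= 1 -> 0 <= t <= 1 ->
  [/\ cabs (f s) <= M, cabs (f' s) <= M &
      cabs (f t - f s - (t - s)%:C * f' s) <= M * (t - s) ^+ 2].

Definition rderiv phi phi' := exists2 M : R, 0 <= M & forall s t, 0 <= s <= 1 -> 0 <= t <= 1 ->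
  `|phi' s| <= M /\ `|phi t - phi s - (t - s) * phi' s| <= M * (t - s) ^+ 2.

Lemma sqr_le_dist s t : 0 <= s <= 1 -> 0 <= t <= 1 -> (t - s) ^+ 2 <= `|t - s|.
Proof.
move=> hs ht; rewrite -real_normK ?num_real // expr2 ler_piMr //.
by rewrite ler_norml; apply/andP; split; lra.
Qed.

Lemma cderiv_lip f f' M s t : 0 <= M -> 0 <= s <= 1 -> 0 <= t <= 1 ->
  cabs (f' s) <= M -> cabs (f t - f s - (t - s)%:C * f' s) <= M * (t - s) ^+ 2 ->
  cabs (f t - f s) <= 2 * M * `|t - s|.
Proof.
move=> M0 hs ht h1 h2; rewrite -(subrK ((t - s)%:C * f' s) (f t - f s)).
apply: le_trans (cabsD _ _) _; rewrite mulr2n 2!mulrDl !mul1r; apply: lerD.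
  by apply: le_trans h2 _; rewrite ler_wpM2l // sqr_le_dist.
by rewrite cabsM cabs_real mulrC ler_wpM2r.
Qed.

Lemma cderiv_cst (z : C) : cderiv (fun=> z) (fun=> 0).
Proof.
exists (cabs z) => [|s t _ _]; first exact: cabs_ge0.
by rewrite mulr0 subrr subr0 cabs0 lexx cabs_ge0 mulr_ge0 ?cabs_ge0 ?sqr_ge0.
Qed.

Lemma cderiv_lin (z : C) : cderiv (fun s => s%:C * z) (fun=> z).
Proof.
exists (cabs z) => [|s t /andP[s0 s1] _]; first exact: cabs_ge0.
rewrite rmorphB /= -mulrBl subrr cabs0 lexx mulr_ge0 ?cabs_ge0 ?sqr_ge0 //.
by split=> //; rewrite cabsM cabs_real ger0_norm // ler_piMl ?cabs_ge0.
Qed.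

Lemma cderivD f f' g g' : cderiv f f' -> cderiv g g' ->
  cderiv (fun s => f s + g s) (fun s => f' s + g' s).
Proof.
move=> [M M0 hf] [N N0 hg]; exists (M + N) => [|s t hs ht]; first exact: addr_ge0.
have [f1 f2 f3] := hf s t hs ht; have [g1 g2 g3] := hg s t hs ht.
split; try by apply: le_trans (cabsD _ _) (lerD _ _).
rewrite mulrDl; apply: le_trans (lerD f3 g3); apply: le_trans (cabsD _ _).
by rewrite le_eqVlt; apply/orP; left; apply/eqP; congr cabs; ring.
Qed.

Lemma cderivM f f' g g' : cderiv f f' -> cderiv g g' ->
  cderiv (fun s => f s * g s) (fun s => f' s * g s + f s * g' s).
Proof.
(* The product of the two increments costs 2M * 2N by the Lipschitz bounds, and each of the two
   remainders costs M N. *)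
move=> [M M0 hf] [N N0 hg]; exists (6 * M * N) => [|s t hs ht].
  by rewrite !mulr_ge0.
have [f1 f2 f3] := hf s t hs ht; have [g1 g2 g3] := hg s t hs ht.
have MN : 0 <= M * N by rewrite mulr_ge0.
have fl := cderiv_lip M0 hs ht f2 f3; have gl := cderiv_lip N0 hs ht g2 g3.
split.
- by apply: le_trans (cabsM_le f1 g1) _; lra.
- apply: le_trans (cabsD _ _) _.
  by apply: le_trans (lerD (cabsM_le f2 g1) (cabsM_le f1 g2)) _; lra.
rewrite (_ : _ - _ = (f t - f s) * (g t - g s) + f s * (g t - g s - (t - s)%:C * g' s)
   + (f t - f s - (t - s)%:C * f' s) * g s); last by ring.
apply: le_trans (cabsD _ _) _.
apply: le_trans (lerD (le_trans (cabsD _ _) (lerD (cabsM_le fl gl) (cabsM_le f1 g3)))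
   (cabsM_le f3 g1)) _.
have e : `|t - s| * `|t - s| = (t - s) ^+ 2 by rewrite -expr2 real_normK ?num_real.
by rewrite (_ : _ * _ * (_ * _ * _) = 4 * M * N * (`|t - s| * `|t - s|)); [rewrite e; lra | ring].
Qed.

Lemma cderivV f f' (c : R) : 0 < c -> (forall s, 0 <= s <= 1 -> c <= cabs (f s)) -> cderiv f f' ->
  cderiv (fun s => (f s)^-1) (fun s => - f' s / f s ^+ 2).
Proof.
move=> c0 fc [M M0 hf].
have ci0 : 0 <= c^-1 by rewrite invr_ge0 ltW.
(* The first summand bounds the inverse, the second its derivative, and the last two together bound
   the remainder. *)
pose N := c^-1 + M * c^-1 ^+ 2 + 4 * M ^+ 2 * c^-1 ^+ 3.
have p1 : 0 <= M * c^-1 ^+ 2 by rewrite mulr_ge0 // exprn_ge0.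
have p2 : 0 <= 4 * M ^+ 2 * c^-1 ^+ 3 by rewrite !mulr_ge0 // exprn_ge0.
have N0 : 0 <= N by rewrite !addr_ge0.
exists N => // s t hs ht; have [f1 f2 f3] := hf s t hs ht.
have fl := cderiv_lip M0 hs ht f2 f3.
have inv u : 0 <= u <= 1 -> f u != 0 /\ cabs (f u)^-1 <= c^-1.
  move=> /fc h; have h0 := lt_le_trans c0 h; rewrite cabs_gt0 in h0; split=> //.
  by rewrite cabsV lef_pV2 // posrE // cabs_gt0.
have [fs0 ifs] := inv s hs; have [ft0 ift] := inv t ht.
have ifs2 : cabs ((f s)^-1 ^+ 2) <= c^-1 ^+ 2 by rewrite cabsX lerXn2r ?nnegrE ?cabs_ge0.
split.
- by apply: le_trans ifs _; rewrite /N; lra.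
- rewrite -exprVn mulNr cabsN; apply: le_trans (cabsM_le f2 ifs2) _.
  by rewrite /N; lra.
rewrite (_ : _ - _ = (f t - f s) * (f t - f s) * ((f s)^-1 ^+ 2 * (f t)^-1)
   - (f t - f s - (t - s)%:C * f' s) * (f s)^-1 ^+ 2); last first.
  by field; rewrite fs0 ft0.
apply: le_trans (cabsB _ _) _.
apply: le_trans (lerD (cabsM_le (cabsM_le fl fl) (cabsM_le ifs2 ift)) (cabsM_le f3 ifs2)) _.
have e : `|t - s| * `|t - s| = (t - s) ^+ 2 by rewrite -expr2 real_normK ?num_real.
rewrite (_ : _ * _ * _ * _ = (4 * M ^+ 2 * c^-1 ^+ 3) * (`|t - s| * `|t - s|)); last by ring.
rewrite e (_ : _ * _ + _ = (M * c^-1 ^+ 2 + 4 * M ^+ 2 * c^-1 ^+ 3) * (t - s) ^+ 2); last by ring.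
by rewrite ler_wpM2r ?sqr_ge0 // /N; lra.
Qed.

Lemma rderiv_cre f f' : cderiv f f' -> rderiv (fun s => cre (f s)) (fun s => cre (f' s)).
Proof.
move=> [M M0 hf]; exists M => // s t hs ht; have [f1 f2 f3] := hf s t hs ht; split.
  exact: le_trans (cre_abs _) f2.
by rewrite -creMr -!creB; apply: le_trans (cre_abs _) f3.
Qed.

Lemma rderivD phi phi' psi psi' : rderiv phi phi' -> rderiv psi psi' ->
  rderiv (fun s => phi s + psi s) (fun s => phi' s + psi' s).
Proof.
move=> [M M0 hf] [N N0 hg]; exists (M + N) => [|s t hs ht]; first exact: addr_ge0.
have [f2 f3] := hf s t hs ht; have [g2 g3] := hg s t hs ht.
split; first by apply: le_trans (ler_normD _ _) (lerD _ _).
rewrite [leRHS]mulrDl; apply: le_trans (lerD f3 g3); apply: le_trans (ler_normD _ _).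
by rewrite le_eqVlt; apply/orP; left; apply/eqP; congr `|_|; ring.
Qed.

Lemma rderivZ a phi phi' : rderiv phi phi' ->
  rderiv (fun s => a * phi s) (fun s => a * phi' s).
Proof.
move=> [M M0 hf]; exists (`|a| * M) => [|s t hs ht]; first exact: mulr_ge0.
have [f2 f3] := hf s t hs ht.
split; first by rewrite normrM ler_wpM2l.
rewrite (_ : _ - _ = a * (phi t - phi s - (t - s) * phi' s)); last by ring.
by rewrite normrM -mulrA ler_wpM2l.
Qed.

Lemma rderiv_ln f f' (c : R) : 0 < c -> (forall s, 0 <= s <= 1 -> c <= cabs (f s)) -> cderiv f f' ->
  rderiv (fun s => ln (cabs (f s))) (fun s => cre (f' s / f s)).
Proof.
move=> c0 fc [M M0 hf].
have ci0 : 0 <= c^-1 by rewrite invr_ge0 ltW.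
(* The first summand bounds the derivative and the linearization error. The second is twice 4 M^2 /
   c^2: once for the square in [ln_cabs_sub_le], once for replacing the denominator f(t) by f(s) in
   the lower bound. *)
pose N := M * c^-1 + 8 * M ^+ 2 * c^-1 ^+ 2.
have p1 : 0 <= M * c^-1 by rewrite mulr_ge0.
have p2 : 0 <= M ^+ 2 * c^-1 ^+ 2 by rewrite !mulr_ge0 // exprn_ge0.
have N0 : 0 <= N by rewrite /N; lra.
exists N => // s t hs ht; have [f1 f2 f3] := hf s t hs ht.
have fl := cderiv_lip M0 hs ht f2 f3.
have inv u : 0 <= u <= 1 -> f u != 0 /\ cabs (f u)^-1 <= c^-1.
  move=> /fc h; have h0 := lt_le_trans c0 h; rewrite cabs_gt0 in h0; split=> //.
  by rewrite cabsV lef_pV2 // posrE // cabs_gt0.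
have [fs0 ifs] := inv s hs; have [ft0 ift] := inv t ht.
split.
  apply: le_trans (cre_abs _) _; apply: le_trans (cabsM_le f2 ifs) _.
  by rewrite /N; lra.
have e : `|t - s| * `|t - s| = (t - s) ^+ 2 by rewrite -expr2 real_normK ?num_real.
set h := t - s in e f3 fl *; set d := f t - f s in f3 fl *; set P := (t - s) ^+ 2.
pose Q := M ^+ 2 * c^-1 ^+ 2 * P.
have Q0 : 0 <= Q by rewrite mulr_ge0 ?sqr_ge0.
have E1 : cre ((d - h%:C * f' s) / f s) <= M * c^-1 * P.
  apply: le_trans (cre_le _) _; apply: le_trans (cabsM_le f3 ifs) _.
  by rewrite -/P mulrAC.
have dist : cre (d / f s) = h * cre (f' s / f s) + cre ((d - h%:C * f' s) / f s).
  by rewrite -creMr -creD; congr complex.Re; rewrite mulrA -mulrDl subrKC.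
have E1' : - cre ((d - h%:C * f' s) / f s) <= M * c^-1 * P.
  rewrite -creN; apply: le_trans (cre_le _) _; rewrite cabsN; apply: le_trans (cabsM_le f3 ifs) _.
  by rewrite -/P mulrAC.
have sq u : 0 <= u <= 1 -> cabs (d / f u) ^+ 2 <= 4 * Q.
  move=> /inv[_ hu]; have := cabsM_le fl hu => k.
  have := ler_pM (cabs_ge0 _) (cabs_ge0 _) k k; rewrite -expr2 => /le_trans; apply.
  by rewrite (_ : _ * _ * _ = 4 * (M ^+ 2 * c^-1 ^+ 2 * (`|h| * `|h|))); [rewrite e | ring].
have up := ln_cabs_sub_le fs0 ft0; have dn := ln_cabs_sub_le ft0 fs0.
have dm : f s - f t = - d by rewrite opprB.
rewrite -/d in up; rewrite dm mulNr cabsN creN in dn.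
have {up} := le_trans up (lerD (lexx _) (sq s hs)).
have {dn} := le_trans dn (lerD (lexx _) (sq t ht)).
have E2 : - cre (d / f t) <= - cre (d / f s) + 4 * Q.
  rewrite -lerBlDl opprK addrC -creB.
  rewrite (_ : _ - _ = (d / f s) * (d / f t)); last first.
    by rewrite /d; field; rewrite fs0 ft0.
  apply: le_trans (cre_le _) _; apply: le_trans (cabsM_le (cabsM_le fl ifs) (cabsM_le fl ift)) _.
  by rewrite (_ : _ * _ = 4 * (M ^+ 2 * c^-1 ^+ 2 * (`|h| * `|h|))); [rewrite e | ring].
have -> : N * P = M * c^-1 * P + 8 * Q by rewrite /N /Q; ring.
rewrite dist in E2 *; move: E1 E1' E2 Q0; move: (M * _ * P) => K.
by rewrite ler_norml => *; apply/andP; split; lra.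
Qed.

(** The Euler derivative g = s f'(s). The derivative f' itself stays hidden, and the relation is
    written as a product so that it makes sense at s = 0, where the logarithmic derivatives used
    later have a pole. *)
Definition ceuler f g := exists2 f', cderiv f f' & forall s, 0 <= s <= 1 -> s%:C * f' s = g s.
Definition reuler phi psi := exists2 phi', rderiv phi phi' &
  forall s, 0 <= s <= 1 -> s * phi' s = psi s.

Lemma ceuler_ext f g g' : (forall s, 0 <= s <= 1 -> g s = g' s) -> ceuler f g -> ceuler f g'.
Proof. by move=> e [f' df h]; exists f' => // s hs; rewrite h // e. Qed.

Lemma ceuler_cst z : ceuler (fun=> z) (fun=> 0).
Proof. by exists (fun=> 0); [exact: cderiv_cst | move=> s _; rewrite mulr0]. Qed.

Lemma ceuler_lin z : ceuler (fun s => s%:C * z) (fun s => s%:C * z).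
Proof. by exists (fun=> z); [exact: cderiv_lin|]. Qed.

Lemma ceulerD f1 g1 f2 g2 : ceuler f1 g1 -> ceuler f2 g2 ->
  ceuler (fun s => f1 s + f2 s) (fun s => g1 s + g2 s).
Proof.
move=> [d1 h1 e1] [d2 h2 e2]; exists (fun s => d1 s + d2 s); first exact: cderivD.
by move=> s hs; rewrite mulrDr e1 // e2.
Qed.

Lemma ceulerM f1 g1 f2 g2 : ceuler f1 g1 -> ceuler f2 g2 ->
  ceuler (fun s => f1 s * f2 s) (fun s => g1 s * f2 s + f1 s * g2 s).
Proof.
move=> [d1 h1 e1] [d2 h2 e2]; exists (fun s => d1 s * f2 s + f1 s * d2 s); first exact: cderivM.
by move=> s hs; rewrite -e1 // -e2 //; ring.
Qed.

Lemma ceulerV f g (c : R) : 0 < c -> (forall s, 0 <= s <= 1 -> c <= cabs (f s)) -> ceuler f g ->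
  ceuler (fun s => (f s)^-1) (fun s => - g s / f s ^+ 2).
Proof.
move=> c0 fc [d h e]; exists (fun s => - d s / f s ^+ 2); first exact: (cderivV c0 fc h).
by move=> s hs; rewrite -e // mulrA mulrN.
Qed.

Lemma ceulerX f g n : ceuler f g ->
  ceuler (fun s => f s ^+ n.+1) (fun s => n.+1%:R * f s ^+ n * g s).
Proof.
move=> h; elim: n => [|n IH].
  apply: ceuler_ext h => s _; by rewrite expr0 !mul1r.
rewrite (_ : (fun s => f s ^+ n.+2) = (fun s => f s * f s ^+ n.+1)); last first.
  by apply/boolp.funext => s; rewrite exprS.
apply: ceuler_ext (ceulerM h IH) => s _.
by rewrite -[n.+2%:R]natr1 !exprS; ring.
Qed.

Lemma ceuler_sum n (F G : nat -> R -> C) : (forall i, ceuler (F i) (G i)) ->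
  ceuler (fun s => \sum_(i < n) F i s) (fun s => \sum_(i < n) G i s).
Proof.
move=> h; elim: n => [|n IH].
  rewrite (_ : (fun s => _) = (fun=> 0)); last by apply/boolp.funext => s; rewrite big_ord0.
  by apply: ceuler_ext (ceuler_cst 0) => s _; rewrite big_ord0.
rewrite (_ : (fun s => _) = (fun s => \sum_(i < n) F i s + F n s)); last first.
  by apply/boolp.funext => s; rewrite big_ord_recr.
by apply: ceuler_ext (ceulerD IH (h n)) => s _; rewrite big_ord_recr.
Qed.

Lemma reuler_cre f g : ceuler f g -> reuler (fun s => cre (f s)) (fun s => cre (g s)).
Proof.
move=> [d h e]; exists (fun s => cre (d s)); first exact: rderiv_cre.
by move=> s hs; rewrite -e // creMr.
Qed.

Lemma reulerD phi1 psi1 phi2 psi2 : reuler phi1 psi1 -> reuler phi2 psi2 ->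
  reuler (fun s => phi1 s + phi2 s) (fun s => psi1 s + psi2 s).
Proof.
move=> [d1 h1 e1] [d2 h2 e2]; exists (fun s => d1 s + d2 s); first exact: rderivD.
by move=> s hs; rewrite mulrDr e1 // e2.
Qed.

Lemma reulerZ a phi psi : reuler phi psi -> reuler (fun s => a * phi s) (fun s => a * psi s).
Proof.
move=> [d h e]; exists (fun s => a * d s); first exact: rderivZ.
by move=> s hs; rewrite mulrCA e.
Qed.

Lemma reuler_ln f g (c : R) : 0 < c -> (forall s, 0 <= s <= 1 -> c <= cabs (f s)) -> ceuler f g ->
  reuler (fun s => ln (cabs (f s))) (fun s => cre (g s / f s)).
Proof.
move=> c0 fc [d h e]; exists (fun s => cre (d s / f s)); first exact: (rderiv_ln c0 fc h).
by move=> s hs; rewrite -e // -creMr mulrA.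
Qed.

(** For s > 0 the bound on the Euler derivative gives |phi'(s)| <= e. Telescoping over n equal
    subintervals turns this into a bound on the increment of phi, up to an error O(1/n). *)
Lemma reuler_small phi psi e : reuler phi psi ->
  (forall s, 0 <= s <= 1 -> `|psi s| <= e * s) -> `|phi 1 - phi 0| <= e.
Proof.
move=> [phi' [M M0 h] hpsi] he.
have d s : 0 < s <= 1 -> `|phi' s| <= e.
  move=> /andP[s0 s1]; have hs : 0 <= s <= 1 by rewrite ltW.
  have := he s hs; rewrite -hpsi // normrM (gtr0_norm s0) mulrC.
  by rewrite ler_pM2r.
(* At s = 0 the equation s phi'(s) = psi(s) says nothing about phi', so the first subinterval uses
   the crude bound M, at a cost of only M/n. *)
pose K (k : nat) : R := if k == 0%N then M else e.
have step n k : (k < n)%N -> 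
    `|phi (k.+1%:R / n%:R) - phi (k%:R / n%:R)| <= K k / n%:R + M / n%:R ^+ 2.
  pose q i : R := i%:R / n%:R; rewrite -/(q k) -/(q k.+1) => kn; have n0 : 0 < n%:R :> R by rewrite ltr0n; lia.
  have q01 i : (i <= n)%N -> 0 <= q i <= 1.
    by move=> hi; rewrite /q divr_ge0 // ler_pdivrMr // mul1r ler_nat.
  have dq : q k.+1 - q k = n%:R^-1.
    by rewrite /q -mulrBl -natr1 addrAC subrr add0r mul1r.
  have [_ ] := h (q k) (q k.+1) (q01 k (ltnW kn)) (q01 k.+1 kn).
  have : `|phi' (q k)| <= K k.
    rewrite /K; case: eqP => [->|/eqP k0].
      by have := h (q 0%N) (q 0%N) (q01 _ (leq0n _)) (q01 _ (leq0n _)) => -[].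
    apply: d; rewrite divr_gt0 ?n0 ?ltr0n ?lt0n //=.
    by have /andP[] := q01 k (ltnW kn).
  move=> hK; rewrite dq exprVn => hh.
  rewrite -(subrK (n%:R^-1 * phi' (q k)) (_ - _)).
  apply: le_trans (ler_normD _ _) _; rewrite [leRHS]addrC; apply: lerD => //.
  by rewrite normrM mulrC; apply: ler_pM => //; rewrite ger0_norm // invr_ge0 ltW.
have tot n : `|phi 1 - phi 0| <= e + 2 * M / n.+1%:R.
  pose N := n.+1; have N0 : N%:R != 0 :> R by rewrite pnatr_eq0.
  have e0 : 0 <= e by apply: le_trans (d 1 _); rewrite ?normr_ge0 // ltr01 lexx.
  have ind k : (k <= N)%N -> `|phi (k%:R / N%:R) - phi 0| <= (M + k%:R * e) / N%:R + k%:R * M / N%:R ^+ 2.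
    elim: k => [_|k IH kN].
      by rewrite mul0r subrr normr0 !mul0r !addr0 divr_ge0.
    rewrite -(subrK (phi (k%:R / N%:R)) (phi (k.+1%:R / _))) -addrA.
    apply: le_trans (ler_normD _ _) _.
    have st := step N k kN; case: k kN IH st => [|k] kN IH; rewrite /K /= => st.
      rewrite mul0r subrr normr0 addr0; rewrite mul0r in st; apply: le_trans st _.
      by rewrite !mul1r lerD2r ler_wpM2r ?invr_ge0 // lerDl.
    apply: le_trans (lerD st (IH (ltnW kN))) _.
    rewrite -[k.+2%:R]natr1; move: (k.+1%:R) => x; rewrite le_eqVlt; apply/orP; left; apply/eqP; ring.
  have := ind N (leqnn _); rewrite divff // => /le_trans; apply.
  rewrite (_ : _ / _ + _ = e + 2 * M / N%:R) //; by field.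
apply/ler_addgt0Pr => eps eps0.
pose n := Num.truncn (2 * M / eps).
apply: le_trans (tot n) _; rewrite lerD2l ler_pdivrMr ?ltr0n // -ler_pdivrMl // mulrC.
by apply: ltW; rewrite -truncn_le_nat // truncnS.
Qed.

End PathCalculus.

(** * Truncated power series *)

Section TruncatedSeries.
Variable R : realType.
Local Notation C := R[i].
Implicit Types (x v z : C) (k n j M : nat).

(** The binomial series of (1-x)^-(k+1), truncated after degree n. *)
Definition negbin k n x : C := \sum_(i < n.+1) 'C(k + i, i)%:R * x ^+ i.

Lemma negbinS k n x :
  (1 - x) * negbin k.+1 n x = negbin k n x - 'C(k.+1 + n, n)%:R * x ^+ n.+1.
Proof.
rewrite /negbin; elim: n => [|n IH].
  by rewrite !big_ord1 !bin0 !expr0 expr1; ring.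
rewrite big_ord_recr /= mulrDr IH [in RHS]big_ord_recr /=.
rewrite [in 'C(k.+1 + n.+1, n.+1)]addnS binS natrD.
rewrite addSnnS; move: (\sum_(_ < _) _) ('C(_, n.+1)%:R) ('C(_, n)%:R) => S a b.
rewrite [x ^+ n.+2]exprS; ring.
Qed.

Lemma cabs_1B_ge x : cabs x <= 2^-1 -> 2^-1 <= cabs (1 - x).
Proof. by move=> h; have := cabs_sub_ge 1 x; rewrite cabs1; lra. Qed.

(** In the induction on k the boundary term obeys the same bound as the inductive error, and
    dividing by 1 - x at most doubles their sum; this is the factor 4 for each step. *)
Lemma negbin_err k n x : cabs x <= 2^-1 ->
  cabs (negbin k n x - (1 - x)^-1 ^+ k.+1) <= 4 ^+ k.+1 * (2 * cabs x) ^+ n.+1.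
Proof.
move=> hx; have h := cabs_1B_ge hx.
have x0 : 1 - x != 0 by rewrite -cabs_gt0; lra.
have hi : cabs (1 - x)^-1 <= 2.
  rewrite cabsV -[2]invrK lef_pV2 ?posrE ?invr_gt0 // cabs_gt0 //.
have r0 : 0 <= cabs x ^+ n.+1 by rewrite exprn_ge0 ?cabs_ge0.
have p2 : 1 <= 2 ^+ n.+1 :> R by rewrite exprn_ege1 // ler1n.
elim: k => [|k IH].
  have e : (1 - x) * negbin 0 n x = 1 - x ^+ n.+1.
    rewrite /negbin -[1 in RHS](expr1n _ n.+1) subrXX; congr (_ * _).
    apply: eq_bigr => i _; rewrite add0n binn mul1r expr1n mul1r //.
  rewrite expr1 (_ : _ - _ = - ((1 - x)^-1 * x ^+ n.+1)); last first.
    by rewrite -[negbin 0 n x](mulKf x0) e; field.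
  rewrite cabsN expr1; apply: le_trans (cabsM_le hi (lexx _)) _.
  rewrite cabsX exprMn mulrA ler_wpM2r //; lra.
rewrite (_ : _ - _ = (1 - x)^-1 * (negbin k n x - (1 - x)^-1 ^+ k.+1 - 'C(k.+1 + n, n)%:R * x ^+ n.+1)); last first.
  rewrite -[negbin k.+1 n x](mulKf x0) negbinS [(1 - x)^-1 ^+ k.+2]exprS; ring.
apply: le_trans (cabsM_le hi (le_trans (cabsB _ _) (lerD IH (lexx _)))) _.
rewrite cabsM cabs_nat cabsX exprMn.
have hb : 'C(k.+1 + n, n)%:R <= 4 ^+ k.+1 * 2 ^+ n.+1 :> R.
  apply: (@le_trans _ _ (2 ^+ (k.+1 + n))).
    by rewrite -natrX ler_nat bin_le_exp2.
  rewrite exprD; apply: ler_pM; rewrite ?exprn_ge0 //.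
    by rewrite lerXn2r ?nnegrE //; lra.
  by rewrite [leRHS]exprS ler_peMl ?exprn_ge0 //; lra.
rewrite [4 ^+ k.+2]exprS; have := ler_wpM2r r0 hb.
move: (4 ^+ k.+1) (2 ^+ n.+1) (cabs x ^+ n.+1) => A B D; lra.
Qed.

Definition franelS M v : C := \sum_(m < M.+1) (franel m)%:R * v ^+ m.
Definition trinomS M v : C := \sum_(j < M.+1) (trinom j)%:R * v ^+ j.

(** The parameters (d, c) treat both formulas at once: (2, 2) is MacMahon's, (1, -4) the cubic one.
    After exchanging the sums, m = i + d j makes the inner sum a truncated binomial series in c
    v. *)
Lemma franelS_swap d (c : C) M v : (0 < d <= 3)%N ->
  (forall n, (franel n)%:R = \sum_(j < n.+1 | (d * j <= n)%N)
     (trinom j)%:R * 'C(n + (3 - d) * j, 3 * j)%:R * c ^+ (n - d * j) :> C) ->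
  franelS M v = \sum_(j < M.+1 | (d * j <= M)%N)
     (trinom j)%:R * v ^+ (d * j) * negbin (3 * j) (M - d * j) (c * v).
Proof.
move=> /andP[d0 d3] hf; rewrite /franelS.
transitivity (\sum_(m < M.+1) \sum_(j < M.+1 | (d * j <= m)%N)
    (trinom j)%:R * 'C(m + (3 - d) * j, 3 * j)%:R * c ^+ (m - d * j) * v ^+ m).
  apply: eq_bigr => m _; rewrite hf big_distrl /=.
  rewrite (big_ord_widen_cond M.+1 (fun j => d * j <= m)%N
    (fun j => (trinom j)%:R * 'C(m + (3 - d) * j, 3 * j)%:R * c ^+ (m - d * j) * v ^+ m)) //.
  apply: eq_bigl => j; apply: andb_idr => h; rewrite ltnS.
  by apply: leq_trans h; rewrite leq_pmull.
rewrite (exchange_big_dep (fun j : 'I_M.+1 => d * j <= M)%N) /=; last first.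
  by move=> m j _ h; apply: leq_trans h _; rewrite -ltnS.
apply: eq_bigr => j hj; rewrite /negbin big_distrr /=.
rewrite -(big_mkord (fun m => d * j <= m)%N
  (fun m => (trinom j)%:R * 'C(m + (3 - d) * j, 3 * j)%:R * c ^+ (m - d * j) * v ^+ m)).
rewrite (big_cat_nat (n := (d * j)%N)) //=; last by rewrite ltnW.
rewrite [X in X + _]big_nat_cond big1 ?add0r; last first.
  by move=> m; case: leqP => //; lia.
rewrite -[X in \sum_(X <= _ < _ | _) _]add0n big_addn subSn // big_mkord.
rewrite big_mkcond /=; apply: eq_bigr => i _; rewrite leq_addl addnK.
have -> : (i + d * j + (3 - d) * j = 3 * j + i)%N by rewrite mulnBl; nia.
rewrite exprMn exprD -[in 'C(_, 3 * j)](@bin_sub (3 * j + i) (3 * j)) ?leq_addr // addKn; ring.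
Qed.

Lemma natrX2_ge M : M.+1%:R <= 2 ^+ M :> R.
Proof. by rewrite -natrX ler_nat ltn_expl. Qed.

(** Both sides are compared term by term in j. For d j <= M the error is that of a truncated
    binomial series; for d j > M only the [trinomS] side has a term, and it is itself small. The
    factor |v| in the bound is what later permits division by s. *)
Lemma franelS_err d (c : C) M v : (0 < d <= 3)%N -> cabs c <= 4 ->
  (forall n, (franel n)%:R = \sum_(j < n.+1 | (d * j <= n)%N)
     (trinom j)%:R * 'C(n + (3 - d) * j, 3 * j)%:R * c ^+ (n - d * j) :> C) ->
  2 ^+ 13 * cabs v <= 1 ->
  cabs (franelS M v - trinomS M (v ^+ d / (1 - c * v) ^+ 3) / (1 - c * v))
    <= 2 ^+ 13 * cabs v / 2 ^+ M.
Proof.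
move=> hd hc hf hv; have /andP[d0 d3] := hd.
set r := cabs v in hv *; have r0 : 0 <= r := cabs_ge0 v.
(* The exponent is 5 + 6: [trinom_le] costs 2^5 for each j, and the factor 4^(3j) in [negbin_err]
   costs 2^6. *)
pose q := 2 ^+ 11 * r.
have q0 : 0 <= q by rewrite mulr_ge0 // exprn_ge0.
have q4 : q <= 4^-1 by rewrite /q; lra.
have hcv : cabs (c * v) <= 4 * r by rewrite cabsM ler_wpM2r.
have r8 : 8 * r <= q by rewrite /q; lra.
have hx : cabs (c * v) <= 2^-1 by lra.
have h1 := cabs_1B_ge hx.
have x0 : 1 - c * v != 0 by rewrite -cabs_gt0; lra.
have hi : cabs (1 - c * v)^-1 <= 2.
  by rewrite cabsV -[2]invrK lef_pV2 ?posrE ?invr_gt0 // cabs_gt0.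
have -> : trinomS M (v ^+ d / (1 - c * v) ^+ 3) / (1 - c * v) =
   \sum_(j < M.+1) (trinom j)%:R * v ^+ (d * j) * (1 - c * v)^-1 ^+ (3 * j).+1.
  rewrite /trinomS big_distrl /=; apply: eq_bigr => j _.
  by rewrite exprMn -exprVn -!exprM [_ ^+ (3 * j).+1]exprS; ring.
rewrite (franelS_swap M v hd hf) big_mkcond /= -sumrB.
have tj j : (trinom j)%:R <= (2 ^+ 5) ^+ j :> R by rewrite -!natrX ler_nat trinom_le.
have bnd j : cabs ((if (d * j <= M)%N then (trinom j)%:R * v ^+ (d * j) * negbin (3 * j) (M - d * j) (c * v) else 0)
    - (trinom j)%:R * v ^+ (d * j) * (1 - c * v)^-1 ^+ (3 * j).+1) <= 4 * q ^+ M.+1.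
  have dj : (j <= d * j)%N by rewrite leq_pmull.
  have pw (a b : nat) (y : R) : (a <= b)%N -> 1 <= y -> y ^+ a <= y ^+ b by move=> ? ?; rewrite ler_weXn2l.
  case: leqP => hj.
    rewrite -mulrBr cabsM cabsM cabs_nat cabsX -/r.
    apply: le_trans (ler_wpM2l _ (negbin_err _ _ hx)) _; first by rewrite mulr_ge0 ?exprn_ge0.
    apply: (@le_trans _ _ ((2 ^+ 5) ^+ j * r ^+ (d * j) * (4 ^+ (3 * j).+1 * q ^+ (M - d * j).+1))).
      apply: ler_pM.
      - by rewrite mulr_ge0 ?exprn_ge0.
      - by rewrite mulr_ge0 // exprn_ge0 // mulr_ge0 // cabs_ge0.
      - by rewrite ler_wpM2r ?exprn_ge0.
      - rewrite ler_wpM2l ?exprn_ge0 // lerXn2r ?nnegrE ?mulr_ge0 ?cabs_ge0 //; lra.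
    rewrite [4 ^+ _]exprS [4 ^+ (3 * j)]exprM (_ : 4 ^+ 3 = 2 ^+ 6); last by ring.
    rewrite (_ : _ * _ * _ = 4 * (((2 ^+ 5) ^+ j * (2 ^+ 6) ^+ j) * r ^+ (d * j) * q ^+ (M - d * j).+1)); last by ring.
    rewrite -exprMn -exprD.
    have eM : M.+1 = (d * j + (M - d * j).+1)%N by rewrite addnS subnKC.
    rewrite [q ^+ M.+1](congr1 _ eM) [q ^+ (_ + _)]exprD ler_wpM2l // ler_wpM2r ?exprn_ge0 //.
    by rewrite /q [leRHS]exprMn ler_wpM2r ?exprn_ge0 // pw // exprn_ege1 // ler1n.
  rewrite sub0r cabsN !cabsM cabs_nat !cabsX -/r.
  apply: (@le_trans _ _ ((2 ^+ 5) ^+ j * r ^+ (d * j) * 2 ^+ (3 * j).+1)).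
    apply: ler_pM; rewrite ?mulr_ge0 ?exprn_ge0 ?cabs_ge0 //.
      by rewrite ler_wpM2r ?exprn_ge0.
    by rewrite lerXn2r ?nnegrE ?cabs_ge0.
  rewrite [2 ^+ (3 * j).+1]exprS [2 ^+ (3 * j)]exprM (_ : _ * _ * _ = 2 * (((2 ^+ 5) ^+ j * (2 ^+ 3) ^+ j) * r ^+ (d * j))); last by ring.
  rewrite -exprMn -exprD.
  apply: (@le_trans _ _ (2 * q ^+ (d * j))).
    rewrite ler_wpM2l // /q [leRHS]exprMn ler_wpM2r ?exprn_ge0 //.
    apply: (@le_trans _ _ ((2 ^+ 8) ^+ (d * j))).
      by rewrite pw // exprn_ege1 // ler1n.
    by rewrite lerXn2r ?nnegrE ?exprn_ge0 // ler_weXn2l // ler1n.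
  apply: ler_pM; rewrite ?exprn_ge0 //; first by rewrite ler_nat.
  by rewrite ler_wiXn2l //; lra.
apply: le_trans (cabs_sum _ _ _) _.
apply: (@le_trans _ _ (\sum_(j < M.+1) 4 * q ^+ M.+1)).
  by apply: ler_sum => j _; exact: bnd.
rewrite sumr_const card_ord -[leLHS]mulr_natr [q ^+ _]exprS.
have qM : q ^+ M <= 4^-1 ^+ M by rewrite lerXn2r ?nnegrE //; lra.
(* One factor q is kept for |v|. The others give 4^-M, which absorbs the number M+1 <= 2^M of terms
   and still leaves 2^-M. *)
apply: (@le_trans _ _ (4 * (q * 4^-1 ^+ M) * 2 ^+ M)).
  apply: ler_pM; rewrite ?natrX2_ge ?mulr_ge0 ?exprn_ge0 //.
  by rewrite ler_wpM2l // ler_wpM2l.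
rewrite (_ : 4^-1 = 2^-1 * 2^-1); last by field.
rewrite exprMn -exprVn (_ : _ * 2 ^+ M = 4 * q * 2^-1 ^+ M * (2^-1 ^+ M * 2 ^+ M)); last by ring.
rewrite -[2^-1 ^+ M * 2 ^+ M]exprMn mulVf ?expr1n ?mulr1 // ler_wpM2r //.
by rewrite /q; lra.
Qed.

Lemma franelS_quadratic M v : 2 ^+ 13 * cabs v <= 1 ->
  cabs (franelS M v - trinomS M (v ^+ 2 / (1 - 2 * v) ^+ 3) / (1 - 2 * v))
    <= 2 ^+ 13 * cabs v / 2 ^+ M.
Proof.
apply: franelS_err => //; first by rewrite cabs_nat ler_nat.
by move=> n; rewrite franel_quadratic; apply: eq_bigr => j _; rewrite mul1n.
Qed.

Lemma franelS_cubic M v : 2 ^+ 13 * cabs v <= 1 ->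
  cabs (franelS M v - trinomS M (v / (1 + 4 * v) ^+ 3) / (1 + 4 * v))
    <= 2 ^+ 13 * cabs v / 2 ^+ M.
Proof.
move=> hv; have -> : 1 + 4 * v = 1 - (-4) * v by ring.
rewrite -[X in X / _ ^+ 3]expr1; apply: franelS_err => //; first by rewrite cabsN cabs_nat.
move=> n; rewrite franel_cubic big_mkcond [RHS]big_mkcond; apply: eq_bigr => j _.
by rewrite mul1n -ltnS ltn_ord.
Qed.

End TruncatedSeries.

(** * Integrals of trigonometric polynomials *)

Section TrigonometricPolynomials.
Local Open Scope classical_set_scope.
Variable R : realType.
Local Notation C := R[i].
Local Notation cre := (@complex.Re R).
Local Notation mu := (@lebesgue_measure R).
Local Notation D := (`[0%R, 1%R]%classic : set R).
Local Notation uc := (@unit_circ R).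
Implicit Types (z : C) (t : R).

Lemma cabs_unit_circ t : cabs (uc t) = 1.
Proof. by rewrite /cabs /= cos2Dsin2 sqrtr1. Qed.

Lemma unit_circ_neq0 t : uc t != 0.
Proof. by rewrite -cabs_gt0 cabs_unit_circ. Qed.

Lemma unit_circ_exprz t (b : int) :
  uc t ^ b = Complex (cos (2 * pi * b%:~R * t)) (sin (2 * pi * b%:~R * t)).
Proof.
have nat_case n : uc t ^ (n%:Z) = Complex (cos (2 * pi * n%:R * t)) (sin (2 * pi * n%:R * t)).
  elim: n => [|n IH]; first by rewrite expr0z !(mulr0, mul0r) cos0 sin0.
  rewrite exprSz IH /unit_circ.
  have -> : 2 * pi * n.+1%:R * t = 2 * pi * t + 2 * pi * n%:R * t by rewrite -natr1; ring.
  rewrite cosD sinD; congr Complex; ring.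
case: b => n; first exact: nat_case.
have u0 := unit_circ_neq0 t.
apply: (@mulfI _ (uc t ^ n.+1%:Z)); first by rewrite expfz_neq0.
rewrite -expfzDr // NegzE subrr expr0z nat_case mulrNz mulrN mulNr cosN sinN -pmulrn.
set x := 2 * pi * n.+1%:R * t; have := cos2Dsin2 x; rewrite !expr2.
move: (cos x) (sin x) => c s cs.
rewrite -[LHS]/(Complex 1 0) -[RHS]/(Complex (c * c - s * - s) (c * - s + s * c)).
by rewrite mulrN opprK cs; congr Complex; ring.
Qed.

Lemma continuous_wave (w x y : R) :
  continuous (fun t => x * cos (w * t) - y * sin (w * t) : R).
Proof.
move=> t.
have cw : (fun u => w * u) @ t --> w * t by apply: cvgMl_tmp; exact: cvg_id.
apply: cvgB; apply: cvgMl_tmp.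
  by apply: (continuous_comp cw); exact: continuous_cos.
by apply: (continuous_comp cw); exact: continuous_sin.
Qed.

Lemma Rintegral_wave (w x y : R) : w != 0 -> sin w = 0 -> cos w = 1 ->
  \int[mu]_(t in D) (x * cos (w * t) - y * sin (w * t)) = 0.
Proof.
move=> w0 sw cw; rewrite /Rintegral.
pose F (t : R) : R := w^-1 * (x * sin (w * t) + y * cos (w * t)).
have dF t : is_derive t 1 F (x * cos (w * t) - y * sin (w * t)).
  rewrite /F; apply: is_derive_eq; rewrite /GRing.scale /= !mulr1 ?mulr0 ?addr0 ?add0r.
  by field.
have cF : continuous F by move=> t; apply: differentiable_continuous; apply/derivable1_diffP; case: (dF t).
rewrite (@continuous_FTC2 _ _ F) //.
- by rewrite /F mulr1 mulr0 sw cw sin0 cos0 !mulr0 !add0r mulr1 -EFinB subrr.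
- exact/continuous_subspaceT/continuous_wave.
- split=> [t _|  |]; first by case: (dF t).
    exact/cvg_at_right_filter/cF.
  exact/cvg_at_left_filter/cF.
- by move=> t _; rewrite derive1E; apply: derive_val.
Qed.

Lemma Rintegral_char z (b : int) :
  \int[mu]_(t in D) cre (z * uc t ^ b) = if b == 0 then cre z else 0.
Proof.
case: eqP => [->|/eqP b0].
  rewrite (@eq_Rintegral _ _ _ mu D (fun=> cre z)); last by move=> t _; rewrite expr0z mulr1.
  by rewrite Rintegral_cst //= lebesgue_measure_itv /= lte01 oppr0 adde0 mulr1.
have w0 : 2 * pi * b%:~R != 0 :> R.
  by rewrite mulf_neq0 ?intr_eq0 // mulf_neq0 // gt_eqF ?pi_gt0.
have e : uc 1 ^ b = 1.
  rewrite (_ : uc 1 = 1) ?exp1rz //.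
  by rewrite /unit_circ mulr1 mulrC mulr_natr cos2pi sin2pi.
have := unit_circ_exprz 1 b; rewrite e mulr1 => -[cw sw].
rewrite -[RHS](Rintegral_wave (complex.Re z) (complex.Im z) w0) //.
by apply: eq_Rintegral => t _; rewrite unit_circ_exprz; case: z.
Qed.

Lemma continuous_char z (b : int) : continuous (fun t => cre (z * uc t ^ b) : R).
Proof.
rewrite (_ : (fun t => _) = (fun t => complex.Re z * cos (2 * pi * b%:~R * t)
   - complex.Im z * sin (2 * pi * b%:~R * t) : R)); first exact: continuous_wave.
by apply/funext => t; rewrite unit_circ_exprz; case: z.
Qed.

(** A trigonometric polynomial is a list of coefficients with frequencies, in which frequencies may
    repeat; sums are then concatenations and no normal form has to be maintained. *)
Definition trig1 (l : seq (C * int)) t : R := \sum_(p <- l) cre (p.1 * uc t ^ p.2).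
Definition mean1 (l : seq (C * int)) : R := \sum_(p <- l | p.2 == 0) cre p.1.

Lemma continuous_trig1 l : continuous (trig1 l : R -> R).
Proof.
rewrite /trig1; elim: l => [|p l IH] t.
  by rewrite (_ : (fun t => _) = (fun=> 0)) ?cvg_cst //; [exact: cvg_cst | apply/funext => u; rewrite big_nil].
rewrite (_ : (fun t => _) = (fun t => cre (p.1 * uc t ^ p.2) + \sum_(p <- l) cre (p.1 * uc t ^ p.2) : R)).
  by apply: cvgD; [exact: continuous_char | exact: IH].
by apply/funext => u; rewrite big_cons.
Qed.

Lemma integrable_continuous (f : R -> R) : continuous f -> mu.-integrable D (EFin \o f).
Proof.
move=> cf; apply: continuous_compact_integrable; first exact: segment_compact.
exact: continuous_subspaceT.
Qed.

Lemma Rintegral_trig1 l : \int[mu]_(t in D) trig1 l t = mean1 l.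
Proof.
elim: l => [|p l IH].
  rewrite /mean1 big_nil (@eq_Rintegral _ _ _ mu D (fun=> 0)) ?Rintegral_cst ?mul0r //.
  by move=> t _; rewrite /trig1 big_nil.
rewrite /mean1 big_cons -/(mean1 l) -IH.
rewrite (@eq_Rintegral _ _ _ mu D (fun t => cre (p.1 * uc t ^ p.2) + trig1 l t)); last first.
  by move=> t _; rewrite /trig1 big_cons.
rewrite RintegralD //; last first.
- exact/integrable_continuous/continuous_trig1.
- exact/integrable_continuous/continuous_char.
by rewrite Rintegral_char; case: ifP => // _; rewrite add0r.
Qed.

Lemma cvg_expr2V (u : nat -> R) (a : R) : (forall M, `|u M - a| <= 2^-1 ^+ M) ->
  u x @[x --> \oo] --> a.
Proof.
move=> h; apply/cvgrPdist_le => e e0.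
have : (2^-1 : R) ^+ n @[n --> \oo] --> (0 : R).
  by apply: cvg_expr; rewrite ger0_norm // invf_lt1 // ltr1n.
move=> /cvgrPdist_le /(_ _ e0); apply: filterS => n.
rewrite sub0r normrN ger0_norm ?exprn_ge0 // => /(le_trans _); apply.
by rewrite distrC.
Qed.

(** Uniform approximation with a known rate gives everything at once: measurability as a pointwise
    limit, integrability since H is a bounded function plus a continuous one, and the integral up to
    the approximation error. *)
Lemma integral_trig1_limit (H : R -> R) (L : nat -> seq (C * int)) :
  (forall M t, `|H t - trig1 (L M) t| <= 2^-1 ^+ M) ->
  exists2 I : R, (\int[mu]_(t in D) (H t)%:E = I%:E)%E &
    forall l d, (forall t, `|H t - trig1 l t| <= d) -> `|I - mean1 l| <= d.
Proof.
move=> hH.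
have mH : measurable_fun D H.
  apply: (@measurable_fun_cvg _ _ _ D (fun M => trig1 (L M))) => [M|t _].
    by apply: measurable_funTS; apply: continuous_measurable_fun; exact: continuous_trig1.
  by apply: cvg_expr2V => M; rewrite distrC.
have i0 l d : (forall t, `|H t - trig1 l t| <= d) ->
    mu.-integrable D (EFin \o (fun t => H t - trig1 l t)).
  move=> hd; apply: measurable_bounded_integrable => //.
  - by rewrite /= lebesgue_measure_itv /= lte01 oppr0 adde0 ltry.
  - apply: measurable_funB => //.
    by apply: measurable_funTS; apply: continuous_measurable_fun; exact: continuous_trig1.
  - exists d; split; first by rewrite num_real.
    by move=> x dx t _; apply: le_trans (hd t) (ltW dx).
have it l : mu.-integrable D (EFin \o trig1 l).
  exact/integrable_continuous/continuous_trig1.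
have iH : mu.-integrable D (EFin \o H).
  have := integrableD _ (i0 _ _ (hH 0%N)) (it (L 0%N)).
  move=> /(_ (measurable_itv _)); congr (_.-integrable _ _).
  by apply/funext => t /=; rewrite -EFinD subrK.
exists (\int[mu]_(t in D) H t).
  by rewrite /Rintegral fineK //; apply: integrable_fin_num.
move=> l d hd; rewrite -Rintegral_trig1 -RintegralB //.
apply: le_trans (le_normr_Rintegral _ (i0 _ _ hd)) _ => //.
have -> : d = \int[mu]_(t in D) d.
  by rewrite Rintegral_cst //= lebesgue_measure_itv /= lte01 oppr0 adde0 mulr1.
apply: le_Rintegral => //.
  by apply: integrable_norm; exact: i0 hd.
apply: integrable_continuous => t; exact: cvg_cst.
Qed.

Definition trig2 (l : seq (C * int * int)) t1 t2 : R :=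
  \sum_(p <- l) cre (p.1.1 * uc t1 ^ p.1.2 * uc t2 ^ p.2).
Definition mean2 (l : seq (C * int * int)) : R :=
  \sum_(p <- l | (p.1.2 == 0) && (p.2 == 0)) cre p.1.1.

(** The one-variable statement is used twice. Integrating over t2 keeps the monomials of frequency 0
    in t2, so the inner integral is again a uniform limit, at the same rate, of the polynomials
    [outer (L M)] in t1. *)
Lemma integral_trig2_limit (H : R -> R -> R) (L : nat -> seq (C * int * int)) :
  (forall M t1 t2, `|H t1 t2 - trig2 (L M) t1 t2| <= 2^-1 ^+ M) ->
  exists2 I : R, (\int[mu]_(t1 in D) \int[mu]_(t2 in D) (H t1 t2)%:E = I%:E)%E &
    forall M, `|I - mean2 (L M)| <= 2^-1 ^+ M.
Proof.
move=> hH.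
pose inner l t1 : seq (C * int) := [seq (p.1.1 * uc t1 ^ p.1.2, p.2) | p : C * int * int <- l].
pose outer l : seq (C * int) := [seq p.1 | p : C * int * int <- l & p.2 == 0].
have innerE l t1 t2 : trig2 l t1 t2 = trig1 (inner l t1) t2 by rewrite /trig1 big_map.
have outerE l t1 : mean1 (inner l t1) = trig1 (outer l) t1.
  by rewrite /trig1 big_map big_filter /mean1 big_map.
have meanE l : mean1 (outer l) = mean2 l.
  by rewrite /mean1 big_map big_filter_cond /mean2; apply: eq_bigl => p; rewrite andbC.
have h1 t1 : exists I : R, (\int[mu]_(t2 in D) (H t1 t2)%:E = I%:E)%E /\
    forall M, `|I - trig1 (outer (L M)) t1| <= 2^-1 ^+ M.
  have [|I hI hl] := @integral_trig1_limit (H t1) (fun M => inner (L M) t1).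
    by move=> M t2; rewrite -innerE.
  by exists I; split=> // M; rewrite -outerE; apply: hl => t2; rewrite -innerE.
have [J hJ] := boolp.choice h1.
have [|I hI hl] := @integral_trig1_limit J (fun M => outer (L M)).
  by move=> M t1; have [] := hJ t1.
exists I.
  by rewrite -hI; apply: eq_integral => t1 _; have [] := hJ t1.
by move=> M; rewrite -meanE; apply: hl => t1; have [] := hJ t1.
Qed.

End TrigonometricPolynomials.

(** * Expansions of the Mahler measures *)

Section LogSeries.
Variable R : realType.
Local Notation C := R[i].
Local Notation cre := (@complex.Re R).
Local Notation "x %:C" := (real_complex R x) (format "x %:C") : ring_scope.
Implicit Types (z v : C) (c : nat -> nat) (M : nat).

(** The terms of degree 1 to M of the sum of c_m v^m / m; for c = 1 this is the truncation of
    -log(1-v). *)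
Definition logS c M v : C := \sum_(m < M) (c m.+1)%:R / m.+1%:R * v ^+ m.+1.

Lemma ceuler_logS c M (f g : R -> C) : ceuler f g ->
  ceuler (fun s => logS c M (f s)) (fun s => (\sum_(m < M) (c m.+1)%:R * f s ^+ m) * g s).
Proof.
move=> h; rewrite /logS.
apply: ceuler_ext (ceuler_sum M (fun m => ceulerM (ceuler_cst ((c m.+1)%:R / m.+1%:R)) (ceulerX m h))) => s _.
rewrite big_distrl /=; apply: eq_bigr => m _.
by rewrite mul0r add0r !mulrA divfK ?pnatr_eq0.
Qed.

Lemma logS0 c M : logS c M 0 = 0.
Proof. by apply: big1 => m _; rewrite expr0n mulr0. Qed.

(** Along s z the Euler derivative is a finite geometric sum, and only -v^(M+1)/(1-v) survives. Its
    modulus is at most 2^-M s, so [reuler_small] applies. *)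
Lemma ln_cabs_1B z M : cabs z <= 2^-1 ->
  `|ln (cabs (1 - z)) + cre (logS (fun=> 1) M z)| <= 2^-1 ^+ M.
Proof.
move=> hz.
pose v (s : R) := s%:C * z; pose f s := 1 - v s.
have hv s : 0 <= s <= 1 -> cabs (v s) = s * cabs z.
  by move=> /andP[s0 _]; rewrite cabsM cabs_real ger0_norm.
have hf s : 0 <= s <= 1 -> 2^-1 <= cabs (f s).
  move=> hs; apply: cabs_1B_ge; rewrite hv //; apply: le_trans hz; rewrite ler_piMl ?cabs_ge0 //.
  by case/andP: hs.
have ev : ceuler v v := ceuler_lin z.
have ef : ceuler f (fun s => - v s).
  rewrite (_ : f = (fun s => 1 + -1 * v s)); last by apply/funext => s; rewrite mulN1r.
  by apply: ceuler_ext (ceulerD (ceuler_cst 1) (ceulerM (ceuler_cst (-1)) ev)) => s _; ring.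
have h20 : 0 < 2^-1 :> R by rewrite invr_gt0.
have main := reulerD (reuler_ln h20 hf ef) (reuler_cre (ceuler_logS (fun=> 1%N) M ev)).
have := reuler_small main; rewrite /f /v /= !mul1r !mul0r subr0 cabs1 ln1 logS0 add0r subr0; apply.
move=> s hs; rewrite -creD.
have x0 : 1 - v s != 0 by rewrite -cabs_gt0; apply: lt_le_trans (hf s hs).
have -> : \sum_(m < M) 1%:R * v s ^+ m = (1 - v s ^+ M) / (1 - v s).
  have := subrXX 1 (v s) M; rewrite expr1n => ->; rewrite [RHS]mulrC mulKf //.
  by apply: eq_bigr => i _; rewrite expr1n.
rewrite -/(v s); have -> : - v s / (1 - v s) + (1 - v s ^+ M) / (1 - v s) * v s
    = - (v s * (v s ^+ M / (1 - v s))) by field.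
apply: le_trans (cre_abs _) _; rewrite cabsN cabsM hv // mulrC.
have /andP[s0 s1] := hs.
have hi : cabs (1 - v s)^-1 <= 2.
  by rewrite cabsV -[2]invrK lef_pV2 ?posrE ?invr_gt0 ?cabs_gt0 //; exact: hf.
have hM : cabs (v s ^+ M) <= 2^-1 ^+ M.
  rewrite cabsX lerXn2r ?nnegrE ?cabs_ge0 // hv //.
  by apply: le_trans hz; rewrite ler_piMl ?cabs_ge0.
have := cabsM_le hM hi => h.
apply: le_trans (ler_pM _ _ h (ler_wpM2l s0 hz)) _; rewrite ?cabs_ge0 ?mulr_ge0 ?cabs_ge0 //.
by rewrite le_eqVlt; apply/orP; left; apply/eqP; field.
Qed.

End LogSeries.

(** * Mahler measures from the moments of a Laurent polynomial *)

Section MahlerExpansion.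
Variable R : realType.
Local Notation C := R[i].
Local Notation cre := (@complex.Re R).
Local Notation uc := (@unit_circ R).
Implicit Types (z w : C) (t x : R) (n m M : nat).

Definition has_mean (H : R -> R -> R) (x : R) :=
  exists2 l : seq (C * int * int), (forall t1 t2, H t1 t2 = trig2 l t1 t2) & mean2 l = x.

Lemma has_mean_ext H H' x x' : (forall t1 t2, H t1 t2 = H' t1 t2) -> x = x' ->
  has_mean H x -> has_mean H' x'.
Proof. by move=> e <- [l h m]; exists l => // t1 t2; rewrite -e. Qed.

Lemma has_mean_monomial z (a b : int) :
  has_mean (fun t1 t2 => cre (z * uc t1 ^ a * uc t2 ^ b)) (if (a == 0) && (b == 0) then cre z else 0).
Proof.
exists [:: (z, a, b)] => [t1 t2|]; first by rewrite /trig2 big_seq1.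
by rewrite /mean2 big_mkcond big_seq1.
Qed.

Lemma has_mean_cst x : has_mean (fun _ _ => x) x.
Proof.
apply: has_mean_ext (has_mean_monomial x%:C%C 0 0) => // t1 t2.
by rewrite !expr0z !mulr1.
Qed.

Lemma has_meanD H1 H2 x1 x2 : has_mean H1 x1 -> has_mean H2 x2 ->
  has_mean (fun t1 t2 => H1 t1 t2 + H2 t1 t2) (x1 + x2).
Proof.
move=> [l1 e1 <-] [l2 e2 <-]; exists (l1 ++ l2) => [t1 t2|].
  by rewrite e1 e2 /trig2 big_cat.
by rewrite /mean2 big_cat.
Qed.

Lemma has_mean_sum n (H : nat -> R -> R -> R) (x : nat -> R) :
  (forall i, (i < n)%N -> has_mean (H i) (x i)) ->
  has_mean (fun t1 t2 => \sum_(i < n) H i t1 t2) (\sum_(i < n) x i).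
Proof.
elim: n => [|n IH] h.
  by apply: has_mean_ext (has_mean_cst 0) => [t1 t2|]; rewrite big_ord0.
apply: has_mean_ext (has_meanD (IH (fun i hi => h i (ltnW hi))) (h n (ltnSn n))) => [t1 t2|];
  by rewrite big_ord_recr.
Qed.

(** On the torus log|P| = log|K| + log|1 - w k|. Expanding the second logarithm in powers of w k and
    taking means replaces k^m by its constant term c_m. The moment hypothesis allows an arbitrary
    complex z, because the real part is taken after multiplying by the coefficient. *)
Lemma mahler_expansion (P : C -> C -> C) (K w : C) (k : R -> R -> C) (c : nat -> nat) :
  K != 0 ->
  (forall t1 t2, cabs (P (uc t1) (uc t2)) = cabs (K * (1 - w * k t1 t2))) ->
  (forall t1 t2, cabs (w * k t1 t2) <= 2^-1) ->
  (forall m z, has_mean (fun t1 t2 => cre (z * k t1 t2 ^+ m)) ((c m)%:R * cre z)) ->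
  exists2 I : R, mahler P = I%:E &
    forall M, `|I - (ln (cabs K) - cre (logS c M w))| <= 2^-1 ^+ M.
Proof.
move=> K0 hP hk hc.
pose H t1 t2 : R := ln (cabs (P (uc t1) (uc t2))).
have HE t1 t2 : H t1 t2 = ln (cabs K) + ln (cabs (1 - w * k t1 t2)).
  rewrite /H hP cabsM lnM ?posrE ?cabs_gt0 //.
  by rewrite -cabs_gt0; apply: lt_le_trans (cabs_1B_ge (hk t1 t2)); rewrite invr_gt0.
have mean M : has_mean (fun t1 t2 => ln (cabs K) - cre (logS (fun=> 1) M (w * k t1 t2)))
    (ln (cabs K) - cre (logS c M w)).
  pose z m := - (m.+1%:R^-1 * w ^+ m.+1) : C.
  have := has_meanD (has_mean_cst (ln (cabs K))) (has_mean_sum (n := M) (fun m _ => hc m.+1 (z m))).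
  apply: has_mean_ext => [t1 t2|]; congr (_ + _); rewrite -creN /logS -sumrN cre_sum.
    by apply: eq_bigr => m _; congr complex.Re; rewrite /z exprMn mulNr; ring.
  apply: eq_bigr => m _; rewrite -creMnat; congr complex.Re; rewrite /z; ring.
(* Choice selects one coefficient list for every M, the sequence that [integral_trig2_limit]
   requires. *)
have [L hL] := boolp.choice (fun M => let: ex_intro2 l a b := mean M in ex_intro
   (fun l => (forall t1 t2, ln (cabs K) - cre (logS (fun=> 1) M (w * k t1 t2)) = trig2 l t1 t2)
     /\ mean2 l = ln (cabs K) - cre (logS c M w)) l (conj a b)).
have [|I hI hl] := @integral_trig2_limit _ H L.
  move=> M t1 t2; have [<- _] := hL M.
  by rewrite HE opprD opprK addrACA subrr add0r; exact: ln_cabs_1B.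
exists I => // M; have [_ <-] := hL M; exact: hl.
Qed.

End MahlerExpansion.

(** * Constant terms of the two Laurent polynomials *)

Section Expansions.
Variable R : realType.
Local Notation C := R[i].
Local Notation cre := (@complex.Re R).
Local Notation uc := (@unit_circ R).
Implicit Types (z w p T x y : C) (i j l m n M : nat).

Lemma exprz_subn x (a b : nat) : x != 0 -> x ^ (a%:Z - b%:Z) = x ^+ a / x ^+ b.
Proof. by move=> x0; rewrite expfzDr // -exprnN. Qed.

Definition g_laurent x y := (x + y) * (x + 1) * (y + 1) / (x * y).
Definition n_laurent x y := (x ^+ 3 + y ^+ 3 + 1) / (x * y).

Lemma g_laurentX x y m : x != 0 -> y != 0 -> g_laurent x y ^+ m =
  \sum_(i < m.+1) \sum_(j < m.+1) \sum_(l < m.+1)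
    ('C(m, i) * 'C(m, j) * 'C(m, l))%:R * x ^ (j%:Z - i%:Z) * y ^ ((i + l)%:Z - m%:Z).
Proof.
move=> x0 y0; rewrite /g_laurent !exprMn exprVn exprMn (exprDn x y) (addrC x) (addrC y) !exprDn.
rewrite -!mulrA big_distrl /=; apply: eq_bigr => i _.
rewrite mulrCA big_distrl /=; apply: eq_bigr => j _.
rewrite [X in _ * X]mulrCA mulrCA big_distrl /=; apply: eq_bigr => l _.
rewrite !expr1n !mul1r !exprz_subn // exprD !natrM.
have im : (i <= m)%N by rewrite -ltnS.
have -> : x ^+ m = x ^+ (m - i) * x ^+ i by rewrite -exprD subnK.
rewrite -!(mulr_natr (_ ^+ _)) -!(mulr_natr (_ * _)).
have : x ^+ i != 0 by rewrite expf_neq0.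
have : x ^+ (m - i) != 0 by rewrite expf_neq0.
have : y ^+ m != 0 by rewrite expf_neq0.
move: (x ^+ i) (x ^+ (m - i)) (y ^+ m) => a b c c0 b0 a0.
by field; rewrite a0 b0 c0.
Qed.

Lemma n_laurentX x y m : x != 0 -> y != 0 -> n_laurent x y ^+ m =
  \sum_(i < m.+1) \sum_(l < i.+1)
    ('C(m, i) * 'C(i, l))%:R * x ^ ((3 * (i - l))%:Z - m%:Z) * y ^ ((3 * l)%:Z - m%:Z).
Proof.
move=> x0 y0; rewrite /n_laurent !exprMn exprVn exprMn (addrC _ 1) (exprDn 1).
rewrite big_distrl /=; apply: eq_bigr => i _.
rewrite expr1n mul1r (exprDn (x ^+ 3)) -mulr_natl -mulrA big_distrl /= big_distrr /=.
apply: eq_bigr => l _.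
rewrite !exprz_subn // !exprM !natrM -(mulr_natr (_ * _)).
have : x ^+ m != 0 by rewrite expf_neq0.
have : y ^+ m != 0 by rewrite expf_neq0.
move: (x ^+ m) (y ^+ m) => a b b0 a0.
by field; rewrite a0 b0.
Qed.

(** A constant term requires j = i and l = m - i in [g_laurentX], which leaves the sum of the
    C(m,i)^3. *)
Lemma g_moment m z :
  has_mean (fun t1 t2 => cre (z * g_laurent (uc t1) (uc t2) ^+ m)) ((franel m)%:R * cre z).
Proof.
pose a i j l : R := ('C(m, i) * 'C(m, j) * 'C(m, l))%:R * cre z.
have mono i j l := has_mean_monomial (('C(m, i) * 'C(m, j) * 'C(m, l))%:R * z)
   (j%:Z - i%:Z) ((i + l)%:Z - m%:Z).
have := has_mean_sum (n := m.+1) (fun i _ => has_mean_sum (n := m.+1)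
  (fun j _ => has_mean_sum (n := m.+1) (fun l _ => mono i j l))).
apply: has_mean_ext => [t1 t2|].
  rewrite g_laurentX ?unit_circ_neq0 // big_distrr /= cre_sum; apply: eq_bigr => i _.
  rewrite big_distrr /= cre_sum; apply: eq_bigr => j _.
  rewrite big_distrr /= cre_sum; apply: eq_bigr => l _.
  by rewrite !mulrA [z * _%:R]mulrC.
rewrite /franel natr_sum big_distrl /=; apply: eq_bigr => i _.
have im : (i <= m)%N by rewrite -ltnS.
rewrite (bigD1 i) //= [X in _ + X]big1 ?addr0; last first.
  move=> j ji; apply: big1 => l _; case: ifP => // /andP[h _].
  by case/eqP: ji; apply: val_inj => /=; move: h; lia.
have hl : (m - i < m.+1)%N by lia.
rewrite (bigD1 (Ordinal hl)) //= [X in _ + X]big1 ?addr0; last first.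
  move=> l li; case: ifP => // /andP[_ h].
  by case/eqP: li; apply: val_inj => /=; move: h im; lia.
rewrite ifT; last by lia.
by rewrite creMnat bin_sub // !expnS expn0 muln1 mulnA.
Qed.

(** The constant term of the m-th power of [n_laurent]: it needs m = 3k with each of x^3, y^3 and 1
    chosen k times, giving the trinomial coefficient (3k)!/k!^3. *)
Definition hesse_mean m : nat := (if 3 %| m then trinom (m %/ 3) else 0)%N.

Lemma n_moment m z :
  has_mean (fun t1 t2 => cre (z * n_laurent (uc t1) (uc t2) ^+ m)) ((hesse_mean m)%:R * cre z).
Proof.
have mono i l := has_mean_monomial (('C(m, i) * 'C(i, l))%:R * z)
   ((3 * (i - l))%:Z - m%:Z) ((3 * l)%:Z - m%:Z).
have := has_mean_sum (n := m.+1) (fun i _ => has_mean_sum (n := i.+1) (fun l _ => mono i l)).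
apply: has_mean_ext => [t1 t2|].
  rewrite n_laurentX ?unit_circ_neq0 // big_distrr /= cre_sum; apply: eq_bigr => i _.
  rewrite big_distrr /= cre_sum; apply: eq_bigr => l _.
  by rewrite !mulrA [z * _%:R]mulrC.
rewrite /hesse_mean; case: ifPn => [/dvdnP[k mk]|m3]; last first.
  rewrite mul0r; apply: big1 => i _; apply: big1 => l _; case: ifP => // /andP[_ h].
  by case/negP: m3; move: h; lia.
rewrite mk mulnK // in mono *.
have hi : (2 * k < (k * 3).+1)%N by lia.
rewrite (bigD1 (Ordinal hi)) //= [X in _ + X]big1 ?addr0; last first.
  move=> i ik; apply: big1 => l _; case: ifP => // /andP[h1 h2].
  by case/eqP: ik; apply: val_inj => /=; have := ltn_ord l; move: h1 h2; lia.
have hl : (k < (2 * k).+1)%N by lia.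
rewrite (bigD1 (Ordinal hl)) //= [X in _ + X]big1 ?addr0; last first.
  move=> l lk; case: ifP => // /andP[_ h].
  by case/eqP: lk; apply: val_inj => /=; move: h; lia.
rewrite ifT; last by lia.
rewrite creMnat /trinom [(k * 3)%N]mulnC; congr (_%:R * _); congr (_ * _)%N.
by rewrite -bin_sub; [congr 'C(_, _); lia | lia].
Qed.

(** The polynomial equals -p^-1 (1 - p [g_laurent]) x y, and [g_laurent] has modulus at most 8 on
    the torus; thus 16|p| <= 1 gives the bound 1/2 required for the expansion. *)
Lemma g_fun_expansion p : p != 0 -> 16 * cabs p <= 1 ->
  exists2 I : R, g_fun p = I%:E &
    forall M, `|I + ln (cabs p) + cre (logS franel M p)| <= 2^-1 ^+ M.
Proof.
move=> p0 hp.
have ip0 : - p^-1 != 0 by rewrite oppr_eq0 invr_eq0.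
have [t1 t2|t1 t2|m z|I hI h] := @mahler_expansion R
  (fun x y => (x + y) * (x + 1) * (y + 1) - p^-1 * x * y) (- p^-1) p
  (fun t1 t2 => g_laurent (uc t1) (uc t2)) franel ip0.
- have x0 := unit_circ_neq0 t1; have y0 := unit_circ_neq0 t2.
  set x := uc t1 in x0 *; set y := uc t2 in y0 *.
  rewrite (_ : _ - _ = (- p^-1 * (1 - p * g_laurent x y)) * (x * y)); last first.
    by rewrite /g_laurent; field; rewrite p0 x0 y0.
  by rewrite [LHS]cabsM [cabs (x * y)]cabsM !cabs_unit_circ !mulr1.
- rewrite /g_laurent cabsM cabsf [cabs (uc t1 * _)]cabsM !cabs_unit_circ mulr1 divr1 !cabsM.
  have u2 (x y : C) : cabs x = 1 -> cabs y = 1 -> cabs (x + y) <= 2.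
    by move=> hx hy; apply: le_trans (cabsD _ _) _; rewrite hx hy.
  have b1 := u2 _ _ (cabs_unit_circ t1) (cabs_unit_circ t2).
  have b2 := u2 _ _ (cabs_unit_circ t1) (@cabs1 R).
  have b3 := u2 _ _ (cabs_unit_circ t2) (@cabs1 R).
  have b := ler_pM (mulr_ge0 (cabs_ge0 _) (cabs_ge0 _)) (cabs_ge0 _)
    (ler_pM (cabs_ge0 _) (cabs_ge0 _) b1 b2) b3.
  apply: le_trans (ler_wpM2l (cabs_ge0 p) b) _; lra.
- exact: g_moment.
exists I => // M; have := h M; rewrite cabsN cabsV lnV ?posrE ?cabs_gt0 //.
by rewrite (_ : _ - (_ - _) = I + ln (cabs p) + cre (logS franel M p)) //; ring.
Qed.

Lemma logS_hesse M w : logS hesse_mean (3 * M) w = 3^-1 * logS trinom M (w ^+ 3).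
Proof.
elim: M => [|M IH]; first by rewrite /logS !big_ord0 mulr0.
rewrite /logS [in RHS]big_ord_recr /= mulrDr -/(logS trinom M (w ^+ 3)) -IH.
rewrite (_ : 3 * M.+1 = (3 * M).+3)%N; last by lia.
rewrite !big_ord_recr /= -/(logS hesse_mean (3 * M) w).
rewrite {2}/hesse_mean ifF; last by lia.
rewrite {2}/hesse_mean ifF; last by lia.
rewrite {2}/hesse_mean ifT; last by lia.
rewrite (_ : (3 * M).+3 = 3 * M.+1)%N; last by lia.
rewrite mulKn // !mul0r !addr0 exprM natrM; congr (_ + _).
by field; rewrite ?pnatr_eq0.
Qed.

(** The factor 27 makes 3 / (27T)^(1/3) equal to 1/w with w^3 = T. The result involves only w^3 and
    |w|, so the choice of cube root disappears. *)
Lemma n_fun_expansion T : T != 0 -> 2 ^+ 9 * cabs T <= 1 ->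
  exists2 I : R, n_fun (27%:R * T) = I%:E &
    forall M, `|3 * I + ln (cabs T) + cre (logS trinom M T)| <= 3 * 2^-1 ^+ M.
Proof.
move=> T0 hT; pose r : C := 3.-root (27%:R * T); pose w := r / 3.
have r3 : r ^+ 3 = 27%:R * T by rewrite /r rootCK.
have w3 : w ^+ 3 = T by rewrite /w expr_div_n r3; field.
have w0 : w != 0 by apply: contra_neq T0 => w0; rewrite -w3 w0 expr0n.
have r0 : r != 0 by apply: contra_neq w0 => r0; rewrite /w r0 mul0r.
(* Here 2^9 = 8^3. On the torus [n_laurent] has modulus at most 3, so |w| <= 1/8 suffices for the
   bound 1/2. *)
have hw : 8 * cabs w <= 1.
  rewrite -(@ler_pXn2r _ 3) ?nnegrE ?mulr_ge0 ?cabs_ge0 //.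
  by rewrite expr1n exprMn -cabsX w3; lra.
have K0 : - w^-1 != 0 by rewrite oppr_eq0 invr_eq0.
have [t1 t2|t1 t2|m z|I hI h] := @mahler_expansion R
  (fun x y => x ^+ 3 + y ^+ 3 + 1 - 3 / r * x * y) (- w^-1) w
  (fun t1 t2 => n_laurent (uc t1) (uc t2)) hesse_mean K0.
- have x0 := unit_circ_neq0 t1; have y0 := unit_circ_neq0 t2.
  set x := uc t1 in x0 *; set y := uc t2 in y0 *.
  rewrite (_ : _ - _ = (- w^-1 * (1 - w * n_laurent x y)) * (x * y)); last first.
    by rewrite /n_laurent /w; field; rewrite r0 x0 y0.
  by rewrite [LHS]cabsM [cabs (x * y)]cabsM !cabs_unit_circ !mulr1.
- rewrite /n_laurent cabsM cabsf [cabs (uc t1 * _)]cabsM !cabs_unit_circ mulr1 divr1.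
  have b : cabs (uc t1 ^+ 3 + uc t2 ^+ 3 + 1) <= 3.
    apply: le_trans (cabsD _ _) _; rewrite cabs1.
    have := cabsD (uc t1 ^+ 3) (uc t2 ^+ 3); rewrite !cabsX !cabs_unit_circ !expr1n; lra.
  apply: le_trans (ler_wpM2l (cabs_ge0 w) b) _; have := cabs_ge0 w; lra.
- exact: n_moment.
exists I => // M.
(* Only exponents divisible by 3 contribute, so truncation at 3M in w is truncation at M in T. *)
have hM := h (3 * M)%N; rewrite logS_hesse w3 cabsN cabsV lnV ?posrE ?cabs_gt0 // in hM.
have lw : ln (cabs T) = 3 * ln (cabs w).
  by rewrite -w3 cabsX lnXn ?cabs_gt0 // mulr_natl.
rewrite lw (_ : 3 * I + _ + _ = 3 * (I - (- ln (cabs w) - cre (3^-1 * logS trinom M T)))); last first.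
  rewrite (_ : 3^-1 * logS trinom M T = (3^-1)%:C%C * logS trinom M T).
    by rewrite creMr; field.
  by rewrite fmorphV rmorph_nat.
rewrite normrM ger0_norm // ler_wpM2l //; apply: le_trans hM _.
by rewrite ler_wiXn2l ?invr_ge0 ?invf_le1 ?ler1n // leq_pmull.
Qed.

End Expansions.

(** * The functional equations *)

Section ModularIdentities.
Variable R : realType.
Local Notation C := R[i].
Local Notation cre := (@complex.Re R).
Local Notation "x %:C" := (real_complex R x) (format "x %:C") : ring_scope.
Implicit Types (u p z : C) (f rho : R -> C) (s : R) (M : nat).

(** Here rho is the Euler derivative of log f. The product form allows f to vanish at s = 0, as s u
    does with rho = 1. *)
Definition logder f rho := ceuler f (fun s => f s * rho s).

Lemma logder_cst z : logder (fun=> z) (fun=> 0).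
Proof. by apply: ceuler_ext (ceuler_cst z) => s _; rewrite mulr0. Qed.

Lemma logder_lin u : logder (fun s => s%:C * u) (fun=> 1).
Proof. by apply: ceuler_ext (ceuler_lin u) => s _; rewrite mulr1. Qed.

Lemma logderM f1 r1 f2 r2 : logder f1 r1 -> logder f2 r2 ->
  logder (fun s => f1 s * f2 s) (fun s => r1 s + r2 s).
Proof. by move=> h1 h2; apply: ceuler_ext (ceulerM h1 h2) => s _; ring. Qed.

Lemma logderV f r (c : R) : 0 < c -> (forall s, 0 <= s <= 1 -> c <= cabs (f s)) ->
  logder f r -> logder (fun s => (f s)^-1) (fun s => - r s).
Proof.
move=> c0 hc h; apply: ceuler_ext (ceulerV c0 hc h) => s hs.
have f0 : f s != 0 by rewrite -cabs_gt0; apply: lt_le_trans (hc s hs).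
by field.
Qed.

Lemma logderX f r n : logder f r -> logder (fun s => f s ^+ n.+1) (fun s => n.+1%:R * r s).
Proof. by move=> h; apply: ceuler_ext (ceulerX n h) => s _; rewrite exprS; ring. Qed.

Lemma logder_ceuler f g (c : R) : 0 < c -> (forall s, 0 <= s <= 1 -> c <= cabs (f s)) ->
  ceuler f g -> logder f (fun s => g s / f s).
Proof.
move=> c0 hc h; apply: ceuler_ext h => s hs.
have f0 : f s != 0 by rewrite -cabs_gt0; apply: lt_le_trans (hc s hs).
by field.
Qed.

(** The Euler operator removes the denominators m; the -1 is the missing term of degree 0. *)
Lemma logder_logS (c : nat -> nat) M f r : c 0%N = 1%N -> logder f r ->
  ceuler (fun s => logS c M (f s))
    (fun s => (\sum_(m < M.+1) (c m)%:R * f s ^+ m - 1) * r s).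
Proof.
move=> c0 h; apply: ceuler_ext (ceuler_logS c M h) => s _.
rewrite big_ord_recl /= c0 expr0 mulr1 addrC addKr mulrA; congr (_ * _).
rewrite big_distrl; apply: eq_bigr => m _; rewrite /= exprSr mulrA //.
Qed.

Lemma logder_franel M f r : logder f r ->
  ceuler (fun s => logS franel M (f s)) (fun s => (franelS M (f s) - 1) * r s).
Proof. by apply: logder_logS; rewrite /franel big_ord1. Qed.

Lemma logder_trinom M f r : logder f r ->
  ceuler (fun s => logS trinom M (f s)) (fun s => (trinomS M (f s) - 1) * r s).
Proof. exact: logder_logS. Qed.

Lemma cabs_path u s : 0 <= s <= 1 -> cabs (s%:C * u) = s * cabs u.
Proof. by move=> /andP[s0 _]; rewrite cabsM cabs_real ger0_norm. Qed.

Lemma cabs_1D_ge z : cabs z <= 2^-1 -> 2^-1 <= cabs (1 + z).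
Proof. by move=> h; rewrite -[z]opprK; apply: cabs_1B_ge; rewrite cabsN. Qed.

Lemma cabs_ge_neq0 (c : R) z : 0 < c -> c <= cabs z -> z != 0.
Proof. by move=> c0 h; rewrite -cabs_gt0; apply: lt_le_trans h. Qed.

Lemma cabsV_le z : 2^-1 <= cabs z -> cabs z^-1 <= 2.
Proof.
move=> h; have h0 : 0 < cabs z by apply: lt_le_trans h; rewrite invr_gt0.
by rewrite cabsV -[2]invrK lef_pV2 ?posrE ?invr_gt0.
Qed.

Lemma half_gt0 : 0 < 2^-1 :> R. Proof. by rewrite invr_gt0. Qed.

(** Three times the first identity after inserting the expansions: 9 log|p| cancels, and the cubes
    in the denominators of the two arguments leave the coefficients -3 and -12. *)
Lemma logS_g_two_n M p : 2 ^+ 16 * cabs p <= 1 ->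
  `| -9 * cre (logS franel M p) - 3 * ln (cabs (1 + 4 * p)) - 12 * ln (cabs (1 - 2 * p))
     + cre (logS trinom M (p / (1 + 4 * p) ^+ 3))
     + 4 * cre (logS trinom M (p ^+ 2 / (1 - 2 * p) ^+ 3))| <= 3 / 2 ^+ M.
Proof.
move=> hp; pose v s := s%:C * p; pose A s := 1 + 4 * v s; pose B s := 1 + -2 * v s.
have hv s : 0 <= s <= 1 -> cabs (v s) = s * cabs p by exact: cabs_path.
have hv1 s : 0 <= s <= 1 -> 2 ^+ 16 * cabs (v s) <= 1.
  move=> hs; rewrite hv //; apply: le_trans hp; rewrite ler_wpM2l // ler_piMl ?cabs_ge0 //.
  by case/andP: hs.
have hA s : 0 <= s <= 1 -> 2^-1 <= cabs (A s).
  by move=> /hv1 h; apply: cabs_1D_ge; rewrite cabsM cabs_nat; lra.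
have hB s : 0 <= s <= 1 -> 2^-1 <= cabs (B s).
  by move=> /hv1 h; apply: cabs_1D_ge; rewrite cabsM cabsN cabs_nat; lra.
have dv : logder v (fun=> 1) := logder_lin p.
have eA : ceuler A (fun s => 4 * v s).
  by apply: ceuler_ext (ceulerD (ceuler_cst 1) (ceulerM (ceuler_cst 4) dv)) => s _; ring.
have eB : ceuler B (fun s => - 2 * v s).
  by apply: ceuler_ext (ceulerD (ceuler_cst 1) (ceulerM (ceuler_cst (-2)) dv)) => s _; ring.
have dA3 := logderX 2 (logderV half_gt0 hA (logder_ceuler half_gt0 hA eA)).
have dB3 := logderX 2 (logderV half_gt0 hB (logder_ceuler half_gt0 hB eB)).
have d1 := logder_trinom M (logderM dv dA3).
have d2 := logder_trinom M (logderM (logderX 1 dv) dB3).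
have main := reulerD (reulerD (reulerD (reulerD
  (reulerZ (-9) (reuler_cre (logder_franel M dv)))
  (reulerZ (-3) (reuler_ln half_gt0 hA eA)))
  (reulerZ (-12) (reuler_ln half_gt0 hB eB)))
  (reuler_cre d1)) (reulerZ 4 (reuler_cre d2)).
have := reuler_small (e := 3 / 2 ^+ M) main.
rewrite /A /B /v /= !mul1r !mul0r !mulr0 !addr0 cabs1 ln1 !expr0n /= !mul0r !logS0 !mulr0 !addr0 subr0.
rewrite !mulNr !exprVn; apply=> s hs.
rewrite -!mulNr -/(v s) -/(A s) -/(B s).
have k1 := hv1 s hs; have h13 : 2 ^+ 13 * cabs (v s) <= 1 by have := cabs_ge0 (v s); lra.
have A0 := cabs_ge_neq0 half_gt0 (hA s hs); have B0 := cabs_ge_neq0 half_gt0 (hB s hs).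
have := franelS_quadratic M h13; have := franelS_cubic M h13.
rewrite (_ : 1 - 2 * v s = B s); last by rewrite /B mulNr.
rewrite -/(A s).
set F := franelS _ _; set T1 := trinomS _ _; set T2 := trinomS _ _.
set e1 := F - T1 / A s; set e2 := F - T2 / B s => he1 he2.
rewrite !exprVn -/T1 -/T2 mulr1 !mulNr -!creMnat -!creN -!creD.
have vE : v s = (A s - 1) / 4 by rewrite /A; field.
have BE : B s = (3 - A s) / 2 by rewrite /B vE; field.
(* If [e1] and [e2] were zero, both values of A would be multiples of F and Z would vanish by (1-8v)
   + 8(1+v) = 9. In general Z is the corresponding combination of these two errors, each of size
   O(s). *)
set Z := (X in complex.Re X); have -> : Z = - ((1 - 8 * v s) * e1 + 8 * (1 + v s) * e2).
  rewrite /Z /e1 /e2; move: A0 B0; rewrite /A /B => A0 B0.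
  by field; rewrite A0 B0.
apply: le_trans (cre_abs _) _; rewrite cabsN.
have b1 : cabs (1 - 8 * v s) <= 2.
  by apply: le_trans (cabsB _ _) _; rewrite cabs1 cabsM cabs_nat; lra.
have b2 : cabs (8 * (1 + v s)) <= 16.
  rewrite cabsM cabs_nat; have := cabsD 1 (v s); rewrite cabs1; lra.
apply: le_trans (cabsD _ _) _.
apply: le_trans (lerD (cabsM_le b1 he1) (cabsM_le b2 he2)) _.
rewrite hv // -mulrDl [leLHS](_ : _ = 18 * 2 ^+ 13 * cabs p * (s / 2 ^+ M)); last by ring.
rewrite (_ : 3 / 2 ^+ M * s = 3 * (s / 2 ^+ M)); last by ring.
rewrite ler_wpM2r ?divr_ge0 ?exprn_ge0 //; first by case/andP: hs.
lra.
Qed.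

(** The second identity after inserting the expansions. In the combination of the logarithms of the
    four arguments both log|u| and log 2 cancel; 18 log|1+u| and -3 log|1+4u+u^2| remain. *)
Lemma logS_n_three_g M u : 2 ^+ 16 * cabs u <= 1 ->
  `| 18 * ln (cabs (1 + u)) - 3 * ln (cabs (1 + 4 * u + u ^+ 2))
     + cre (logS trinom M (u * (1 + u) ^+ 4 / (2 * (1 + 4 * u + u ^+ 2) ^+ 3)))
     - cre (logS franel M (u / (2 * (1 + u) ^+ 2)))
     + 8 * cre (logS franel M (- (u * (1 + u) / 2)))
     - 4 * cre (logS franel M (u ^+ 2 / (4 * (1 + u))))| <= 2 ^+ 7 / 2 ^+ M.
Proof.
move=> hu; pose v s := s%:C * u; pose E s := 1 + v s; pose H s := 1 + 4 * v s + v s ^+ 2.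
have hv s : 0 <= s <= 1 -> cabs (v s) = s * cabs u by exact: cabs_path.
have hv1 s : 0 <= s <= 1 -> 2 ^+ 16 * cabs (v s) <= 1.
  move=> hs; rewrite hv //; apply: le_trans hu; rewrite ler_wpM2l // ler_piMl ?cabs_ge0 //.
  by case/andP: hs.
have hv2 s : 0 <= s <= 1 -> cabs (v s ^+ 2) <= cabs (v s).
  move=> hs; have h := hv1 s hs; have h0 := cabs_ge0 (v s).
  by rewrite cabsX expr2 ler_piMl //; lra.
have hE s : 0 <= s <= 1 -> 2^-1 <= cabs (E s).
  by move=> /hv1 h; apply: cabs_1D_ge; have := cabs_ge0 (v s); lra.
have hH s : 0 <= s <= 1 -> 2^-1 <= cabs (H s).
  move=> hs; have h := hv1 s hs; rewrite /H -addrA; apply: cabs_1D_ge.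
  apply: le_trans (cabsD _ _) _; rewrite cabsM cabs_nat.
  by have := hv2 s hs; have := cabs_ge0 (v s); lra.
have dv : logder v (fun=> 1) := logder_lin u.
have eE : ceuler E v.
  by apply: ceuler_ext (ceulerD (ceuler_cst 1) dv) => s _; ring.
have eH : ceuler H (fun s => 4 * v s + 2 * v s ^+ 2).
  apply: ceuler_ext (ceulerD (ceulerD (ceuler_cst 1) (ceulerM (ceuler_cst 4) dv)) (logderX 1 dv)) => s _.
  by ring.
have dE := logder_ceuler half_gt0 hE eE; have dH := logder_ceuler half_gt0 hH eH.
have dEV := logderV half_gt0 hE dE; have dHV := logderV half_gt0 hH dH.
have dp1 := logderM (logderM dv (logder_cst 2^-1)) (logderX 1 dEV).
have dq2 := logderM (logderM dv dE) (logder_cst (- 2^-1)).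
have dq3 := logderM (logderM (logderX 1 dv) (logder_cst 4^-1)) dEV.
have dU := logderM (logderM (logderM dv (logderX 3 dE)) (logder_cst 2^-1)) (logderX 2 dHV).
pose p1 s := v s / 2 * (E s)^-1 ^+ 2; pose q2 s := v s * E s * - 2^-1.
pose q3 s := v s ^+ 2 / 4 * (E s)^-1; pose U s := v s * E s ^+ 4 / 2 * (H s)^-1 ^+ 3.
have main := reulerD (reulerD (reulerD (reulerD (reulerD
  (reulerZ 18 (reuler_ln half_gt0 hE eE))
  (reulerZ (-3) (reuler_ln half_gt0 hH eH)))
  (reuler_cre (logder_trinom M dU)))
  (reulerZ (-1) (reuler_cre (logder_franel M dp1))))
  (reulerZ 8 (reuler_cre (logder_franel M dq2))))
  (reulerZ (-4) (reuler_cre (logder_franel M dq3))).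
have v0 : v 0 = 0 by rewrite /v mul0r.
have v1 : v 1 = u by rewrite /v mul1r.
have small := reuler_small (e := 2 ^+ 7 / 2 ^+ M) main.
rewrite -/(p1 0) -/(p1 1) -/(q2 0) -/(q2 1) -/(q3 0) -/(q3 1) -/(U 0) -/(U 1) in small.
have E1 : E 1 = 1 + u by rewrite /E v1.
have H1 : H 1 = 1 + 4 * u + u ^+ 2 by rewrite /H v1.
have p11 : p1 1 = u / (2 * (1 + u) ^+ 2) by rewrite /p1 v1 E1 exprVn [in RHS]invfM [RHS]mulrA.
have q21 : q2 1 = - (u * (1 + u) / 2) by rewrite /q2 v1 E1 mulrN.
have q31 : q3 1 = u ^+ 2 / (4 * (1 + u)) by rewrite /q3 v1 E1 [in RHS]invfM [RHS]mulrA.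
have U1 : U 1 = u * (1 + u) ^+ 4 / (2 * (1 + 4 * u + u ^+ 2) ^+ 3).
  by rewrite /U v1 E1 H1 exprVn [in RHS]invfM [RHS]mulrA.
have E00 : E 0 = 1 by rewrite /E v0 addr0.
have H00 : H 0 = 1 by rewrite /H v0 expr0n mulr0 !addr0.
have p10 : p1 0 = 0 by rewrite /p1 v0 !mul0r.
have q20 : q2 0 = 0 by rewrite /q2 v0 !mul0r.
have q30 : q3 0 = 0 by rewrite /q3 v0 expr0n !mul0r.
have U0 : U 0 = 0 by rewrite /U v0 !mul0r.
move: small; rewrite E1 H1 p11 q21 q31 U1 E00 H00 p10 q20 q30 U0 !logS0 cabs1 ln1 /= !mulr0 !addr0 subr0.
rewrite !mulN1r !mulNr; apply=> s hs.
rewrite -/(p1 s) -/(q2 s) -/(q3 s) -/(U s).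
have k1 := hv1 s hs; have vp := cabs_ge0 (v s); have v2 := hv2 s hs.
have Es0 := cabs_ge_neq0 half_gt0 (hE s hs); have Hs0 := cabs_ge_neq0 half_gt0 (hH s hs).
(* The common numerator of 1 - 2 p1, 1 - 2 q2 and 1 + 4 q3, shown in [f2], [f3] and [f4]. *)
pose G := 1 + v s + v s ^+ 2.
have G0 : G != 0.
  apply: (cabs_ge_neq0 half_gt0); rewrite /G -addrA; apply: cabs_1D_ge.
  by apply: le_trans (cabsD _ _) _; lra.
have iE := cabsV_le (hE s hs); have iH := cabsV_le (hH s hs).
have Eb : cabs (E s) <= 2 by apply: le_trans (cabsD _ _) _; rewrite cabs1; lra.
have cp1 : cabs (p1 s) <= 2 * cabs (v s).
  have := cabsM_le (lexx (cabs (v s / 2))) (cabsM_le iE iE).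
  by rewrite cabsf cabs_nat -expr2; lra.
have cq2 : cabs (q2 s) <= 2 * cabs (v s).
  rewrite /q2 cabsM [cabs (v s * _)]cabsM cabsN cabsV cabs_nat; have := ler_wpM2l vp Eb; lra.
have cq3 : cabs (q3 s) <= 2 * cabs (v s).
  have := cabsM_le (lexx (cabs (v s ^+ 2 / 4))) iE.
  by rewrite [cabs (_ / 4)]cabsf cabs_nat; lra.
have h13 (x : C) : cabs x <= 2 * cabs (v s) -> 2 ^+ 13 * cabs x <= 1 by lra.
(* All three arguments have modulus at most 2|v|, so one bound serves the four truncated functional
   equations. *)
pose eps : R := 2 ^+ 14 * cabs (v s) / 2 ^+ M.
have he (x y : C) : cabs x <= 2 * cabs (v s) -> cabs y <= 2 ^+ 13 * cabs x / 2 ^+ M -> cabs y <= eps.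
  move=> hx /le_trans; apply; rewrite /eps ler_wpM2r ?invr_ge0 ?exprn_ge0 //; lra.
(* V is the common value of p^2 / (1 - 2 p)^3 at p1, q2 and of p / (1 + 4 p)^3 at q3. *)
pose V := v s ^+ 2 * E s ^+ 2 / (4 * G ^+ 3).
have EE : E s = 1 + v s by [].
have HE : H s = 1 + 4 * v s + v s ^+ 2 by [].
have p1E : p1 s = v s / (2 * E s ^+ 2) by rewrite /p1; field.
have f1 : 1 + 4 * p1 s = H s / E s ^+ 2.
  by rewrite p1E HE; move: Es0; rewrite EE => Es0; field.
have f2 : 1 - 2 * p1 s = G / E s ^+ 2.
  by rewrite p1E /G; move: Es0; rewrite EE => Es0; field.
have f3 : 1 - 2 * q2 s = G by rewrite /q2 /G EE; field.
have f4 : 1 + 4 * q3 s = G / E s.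
  by rewrite /q3 /G; move: Es0; rewrite EE => Es0; field.
have := he _ _ cp1 (franelS_cubic M (h13 _ cp1)).
have := he _ _ cp1 (franelS_quadratic M (h13 _ cp1)).
have := he _ _ cq2 (franelS_quadratic M (h13 _ cq2)).
have := he _ _ cq3 (franelS_cubic M (h13 _ cq3)).
rewrite f1 f2 f3 f4.
have -> : p1 s / (H s / E s ^+ 2) ^+ 3 = U s by rewrite p1E /U; field; rewrite Es0 Hs0.
have -> : p1 s ^+ 2 / (G / E s ^+ 2) ^+ 3 = V by rewrite p1E /V; field; rewrite Es0 G0.
have -> : q2 s ^+ 2 / G ^+ 3 = V by rewrite /q2 /V; field.
have -> : q3 s / (G / E s) ^+ 3 = V by rewrite /q3 /V; field; rewrite Es0 G0.
set W := trinomS _ V; set AU := trinomS _ _.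
set F1 := franelS _ (p1 s); set F2 := franelS _ (q2 s); set F3 := franelS _ (q3 s).
set e4 := F3 - _; set e3 := F2 - _; set e2 := F1 - _; set e1 := F1 - _ => h4 h3 h2 h1.
set a := v s / E s; set b := (4 * v s + 2 * v s ^+ 2) / H s.
rewrite !addr0 ?mulr1 !mulN1r !mulNr -!creMnat -!creN -!creD.
set Z := (X in complex.Re X).
(* Up to the errors, F1, F2 and F3 are multiples of A(V), and A(U) is a multiple of F1, hence of
   A(V) too; its total coefficient is zero. The factors 1-2a, 1+a, 2-a and 1+4a-3b are the
   logarithmic Euler derivatives of p1, q2, q3 and U, and e2 - e1 eliminates F1 from the relation
   between A(U) and A(V). *)
have -> : Z = - ((1 - 2 * a) * e2) + 8 * ((1 + a) * e3) - 4 * ((2 - a) * e4)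
   + (1 + 4 * a - 3 * b) * (H s / E s ^+ 2) * (e2 - e1).
  rewrite /Z /e1 /e2 /e3 /e4 /a /b.
  move: Es0 Hs0 G0; rewrite HE EE /G => Es0 Hs0 G0.
  by field; rewrite Es0 Hs0 G0.
have ca : cabs a <= 1.
  by have := cabsM_le (lexx (cabs (v s))) iE; rewrite /a; lra.
have cb : cabs b <= 1.
  have c : cabs (4 * v s + 2 * v s ^+ 2) <= 6 * cabs (v s).
    by apply: le_trans (cabsD _ _) _; rewrite [cabs (4 * _)]cabsM [cabs (2 * _)]cabsM !cabs_nat; lra.
  by have := cabsM_le c iH; rewrite /b; lra.
have cH : cabs (H s / E s ^+ 2) <= 2.
  rewrite -f1; apply: le_trans (cabsD _ _) _; rewrite cabs1 cabsM cabs_nat; lra.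
have c1 : cabs (1 - 2 * a) <= 3.
  by apply: le_trans (cabsB _ _) _; rewrite cabs1 cabsM cabs_nat; lra.
have c2 : cabs (1 + a) <= 2 by apply: le_trans (cabsD _ _) _; rewrite cabs1; lra.
have c3 : cabs (2 - a) <= 3 by apply: le_trans (cabsB _ _) _; rewrite cabs_nat; lra.
have c4 : cabs (1 + 4 * a - 3 * b) <= 8.
  apply: le_trans (cabsB _ _) _; have := cabsD 1 (4 * a).
  by rewrite cabs1 [cabs (4 * _)]cabsM [cabs (3 * _)]cabsM !cabs_nat; lra.
have t1 := cabsM_le c1 h2; have t2 := cabsM_le c2 h3; have t3 := cabsM_le c3 h4.
have t4 := cabsM_le (cabsM_le c4 cH) (le_trans (cabsB _ _) (lerD h2 h1)).
(* The coefficient bounds add up to 3 + 16 + 12 + 32 = 63, below 2^9 / 2^2. *)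
have tot : cabs (- ((1 - 2 * a) * e2) + 8 * ((1 + a) * e3) - 4 * ((2 - a) * e4)
   + (1 + 4 * a - 3 * b) * (H s / E s ^+ 2) * (e2 - e1)) <= 2 ^+ 9 * eps / 2 ^+ 2.
  apply: le_trans (cabsD _ _) _.
  apply: le_trans (lerD (le_trans (cabsB _ _) (lerD (cabsD _ _) (lexx _))) t4) _.
  rewrite cabsN [cabs (8 * _)]cabsM [cabs (4 * _)]cabsM !cabs_nat.
  have := cabs_ge0 e2; lra.
apply: le_trans (cre_abs _) _; apply: le_trans tot _.
rewrite /eps hv // (_ : _ / 2 ^+ 2 = 2 ^+ 21 * cabs u * (s / 2 ^+ M)); last by field; rewrite ?expf_neq0.
rewrite (_ : 2 ^+ 7 / 2 ^+ M * s = 2 ^+ 7 * (s / 2 ^+ M)); last by ring.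
rewrite ler_wpM2r ?divr_ge0 ?exprn_ge0 //; first by case/andP: hs.
lra.
Qed.

End ModularIdentities.

(** * From truncated relations to equality of Mahler measures *)

Section FunctionalEquations.
Variable R : realType.
Local Notation C := R[i].
Local Notation cre := (@complex.Re R).
Implicit Types (u p z w : C).

Lemma eq0_of_geometric_bound (x K : R) : (forall M : nat, `|x| <= K / 2 ^+ M) -> x = 0.
Proof.
move=> h; apply/eqP; rewrite -normr_eq0; apply/negPn/negP => x0.
have xp : 0 < `|x| by rewrite lt_def x0 normr_ge0.
pose M := Num.truncn (K / `|x|).
have h1 : K / `|x| < M.+1%:R by rewrite -truncn_le_nat // truncnS.
have h2 : M.+1%:R <= 2 ^+ M :> R := natrX2_ge R M.
have := h M; rewrite ler_pdivlMr ?exprn_gt0 // leNgt => /negP; apply.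
by rewrite mulrC -ltr_pdivrMr //; apply: lt_le_trans h2.
Qed.

Lemma ln_cabsM z w : z != 0 -> w != 0 -> ln (cabs (z * w)) = ln (cabs z) + ln (cabs w).
Proof. by move=> z0 w0; rewrite cabsM lnM ?posrE ?cabs_gt0. Qed.

Lemma ln_cabsV z : z != 0 -> ln (cabs z^-1) = - ln (cabs z).
Proof. by move=> z0; rewrite cabsV lnV ?posrE ?cabs_gt0. Qed.

Lemma ln_cabsX z n : z != 0 -> ln (cabs (z ^+ n)) = n%:R * ln (cabs z).
Proof. by move=> z0; rewrite cabsX lnXn ?cabs_gt0 // mulr_natl. Qed.

Lemma g_fun_two_n_fun p : p != 0 -> 2 ^+ 16 * cabs p <= 1 ->
  (3%:E * g_fun p = n_fun (27%:R * p / (1 + 4%:R * p) ^+ 3)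
     + 4%:E * n_fun (27%:R * p ^+ 2 / (1 - 2%:R * p) ^+ 3))%E.
Proof.
move=> p0 hp; have cp := cabs_ge0 p.
have hA : 2^-1 <= cabs (1 + 4 * p) by apply: cabs_1D_ge; rewrite cabsM cabs_nat; lra.
have hB : 2^-1 <= cabs (1 - 2 * p) by apply: cabs_1B_ge; rewrite cabsM cabs_nat; lra.
have A0 := cabs_ge_neq0 (half_gt0 R) hA; have B0 := cabs_ge_neq0 (half_gt0 R) hB.
rewrite -(mulrA 27%:R p) -(mulrA 27%:R (p ^+ 2)).
have hp2 : cabs (p ^+ 2) <= cabs p by rewrite cabsX expr2 ler_piMl //; lra.
have inv3 z : 2^-1 <= cabs z -> cabs (z ^+ 3)^-1 <= 8.
  move=> /cabsV_le h; rewrite -exprVn !exprS expr0 mulr1.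
  by apply: le_trans (cabsM_le h (cabsM_le h h)) _; lra.
have bnd z w : cabs z <= cabs p -> 2^-1 <= cabs w -> 2 ^+ 9 * cabs (z / w ^+ 3) <= 1.
  by move=> hz /inv3 hw; have := cabsM_le hz hw; lra.
have [|Ig -> hg] := g_fun_expansion p0; first by lra.
have P10 : p / (1 + 4 * p) ^+ 3 != 0 by rewrite mulf_neq0 // invr_neq0 // expf_neq0.
have P20 : p ^+ 2 / (1 - 2 * p) ^+ 3 != 0 by rewrite mulf_neq0 ?expf_neq0 // invr_neq0 // expf_neq0.
have [I1 -> h1] := n_fun_expansion P10 (bnd _ _ (lexx _) hA).
have [I2 -> h2] := n_fun_expansion P20 (bnd _ _ hp2 hB).
rewrite -!EFinM -EFinD; congr EFin; apply/eqP; rewrite -subr_eq0; apply/eqP.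
(* Three times the difference is bounded by 9 + 3 + 12 + 3 = 27 units of 2^-M: one expansion of g,
   two of n, and [logS_g_two_n]. *)
apply: (@eq0_of_geometric_bound _ 9) => M.
have := hg M; have := h1 M; have := h2 M; have := logS_g_two_n M hp.
rewrite !ln_cabsM ?ln_cabsV ?ln_cabsX ?invr_neq0 ?expf_neq0 // !exprVn.
have : 0 <= (2 ^+ M)^-1 :> R by rewrite invr_ge0 exprn_ge0.
move: (2 ^+ M)^-1 => e e0; rewrite !ler_norml.
move=> /andP[? ?] /andP[? ?] /andP[? ?] /andP[? ?]; apply/andP; split; lra.
Qed.

Lemma n_fun_three_g_fun u : u != 0 -> 2 ^+ 16 * cabs u <= 1 ->
  (3%:E * n_fun (27%:R * u * (1 + u) ^+ 4 / (2%:R * (1 + 4%:R * u + u ^+ 2) ^+ 3)) =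
   g_fun (u / (2%:R * (1 + u) ^+ 2)) - 8%:E * g_fun (- (u * (1 + u) / 2%:R))
   + 4%:E * g_fun (u ^+ 2 / (4%:R * (1 + u))))%E.
Proof.
move=> u0 hu; have cu := cabs_ge0 u.
have hu2 : cabs (u ^+ 2) <= cabs u by rewrite cabsX expr2 ler_piMl //; lra.
have hE : 2^-1 <= cabs (1 + u) by apply: cabs_1D_ge; lra.
have hH : 2^-1 <= cabs (1 + 4 * u + u ^+ 2).
  rewrite -addrA; apply: cabs_1D_ge.
  by apply: le_trans (cabsD _ _) _; rewrite cabsM cabs_nat; lra.
have E2 : cabs (1 + u) <= 2 by apply: le_trans (cabsD _ _) _; rewrite cabs1; lra.
have iE := cabsV_le hE; have iH := cabsV_le hH.
have E0 := cabs_ge_neq0 (half_gt0 R) hE; have H0 := cabs_ge_neq0 (half_gt0 R) hH.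
have n2 : 2 != 0 :> C by rewrite pnatr_eq0.
have n4 : 4 != 0 :> C by rewrite pnatr_eq0.
have i2 : cabs (2^-1 : C) = 2^-1 by rewrite cabsV cabs_nat.
have i4 : cabs (4^-1 : C) = 4^-1 by rewrite cabsV cabs_nat.
rewrite -(mulrA 27%:R u) -(mulrA 27%:R (u * _)).
have nU : u * (1 + u) ^+ 4 / (2 * (1 + 4 * u + u ^+ 2) ^+ 3) != 0.
  by rewrite !(mulf_neq0, invr_neq0, expf_neq0).
have np1 : u / (2 * (1 + u) ^+ 2) != 0 by rewrite !(mulf_neq0, invr_neq0, expf_neq0).
have nq2 : - (u * (1 + u) / 2) != 0 by rewrite oppr_eq0 !(mulf_neq0, invr_neq0, expf_neq0).
have nq3 : u ^+ 2 / (4 * (1 + u)) != 0 by rewrite !(mulf_neq0, invr_neq0, expf_neq0).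
have [|I0 -> h0] := n_fun_expansion nU.
  rewrite [cabs (u * _ / _)]cabsM invfM [cabs (2^-1 * _)]cabsM i2 -exprVn !cabsX [cabs (u * _)]cabsM cabsX.
  have e4 : cabs (1 + u) ^+ 4 <= 2 ^+ 4 by rewrite lerXn2r ?nnegrE ?cabs_ge0.
  have h3 : cabs (1 + 4 * u + u ^+ 2)^-1 ^+ 3 <= 2 ^+ 3 by rewrite lerXn2r ?nnegrE ?cabs_ge0.
  have := ler_pM (mulr_ge0 cu (exprn_ge0 4 (cabs_ge0 _))) (exprn_ge0 3 (cabs_ge0 _)) (ler_wpM2l cu e4) h3.
  by lra.
have [|I1 -> h1] := g_fun_expansion np1.
  rewrite invfM mulrA [cabs (_ * (_ ^+ 2)^-1)]cabsM [cabs (u / 2)]cabsM i2 -exprVn cabsX.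
  have h3 : cabs (1 + u)^-1 ^+ 2 <= 2 ^+ 2 by rewrite lerXn2r ?nnegrE ?cabs_ge0.
  by have := ler_wpM2l cu h3; lra.
have [|I2 -> h2] := g_fun_expansion nq2.
  rewrite cabsN [cabs (_ / 2)]cabsM [cabs (u * _)]cabsM i2.
  by have := ler_wpM2l cu E2; lra.
have [|I3 -> h3] := g_fun_expansion nq3.
  rewrite invfM mulrA [cabs (_ * (1 + u)^-1)]cabsM [cabs (_ / 4)]cabsM i4.
  by have := cabsM_le hu2 iE; rewrite cabsM; lra.
rewrite -!EFinM -EFinB -EFinD; congr EFin; apply/eqP; rewrite -subr_eq0; apply/eqP.
(* The expansions contribute 3 + 1 + 8 + 4 units of 2^-M and [logS_n_three_g] contributes 2^7, which
   is less than 2^8 in total. *)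
apply: (@eq0_of_geometric_bound _ (2 ^+ 8)) => M.
have := h0 M; have := h1 M; have := h2 M; have := h3 M; have := logS_n_three_g M hu.
(* Expressing log 4 through log 2 lets the constant logarithms cancel in the linear arithmetic
   below. *)
have l4 : ln (cabs (4 : C)) = 2 * ln (cabs (2 : C)).
  by rewrite -(ln_cabsX 2 n2); congr (ln (cabs _)); ring.
rewrite cabsN !ln_cabsM ?ln_cabsV ?ln_cabsM ?ln_cabsX ?l4 ?(mulf_neq0, invr_neq0, expf_neq0) // !exprVn.
have : 0 <= (2 ^+ M)^-1 :> R by rewrite invr_ge0 exprn_ge0.
move: (2 ^+ M)^-1 => e e0; rewrite !ler_norml.
move=> /andP[? ?] /andP[? ?] /andP[? ?] /andP[? ?] /andP[? ?]; apply/andP; split; lra.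
Qed.

End FunctionalEquations.

Theorem mainTheorem10 (R : realType) :
  (exists eps : R, 0 < eps /\
     forall p : R[i], 0 < ComplexField.Normc.normc p < eps ->
       (3%:E * g_fun p =
        n_fun (27%:R * p / (1 + 4%:R * p) ^+ 3)
        + 4%:E * n_fun (27%:R * p ^+ 2 / (1 - 2%:R * p) ^+ 3))%E)
  /\
  (exists eps : R, 0 < eps /\
     forall u : R[i], 0 < ComplexField.Normc.normc u < eps ->
       (3%:E * n_fun (27%:R * u * (1 + u) ^+ 4 / (2%:R * (1 + 4%:R * u + u ^+ 2) ^+ 3)) =
        g_fun (u / (2%:R * (1 + u) ^+ 2))
        - 8%:E * g_fun (- (u * (1 + u) / 2%:R))
        + 4%:E * g_fun (u ^+ 2 / (4%:R * (1 + u))))%E).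
Proof.
have eps0 : 0 < (2 ^+ 16)^-1 :> R by rewrite invr_gt0 exprn_gt0.
have small (z : R[i]) : 0 < cabs z < (2 ^+ 16)^-1 -> z != 0 /\ 2 ^+ 16 * cabs z <= 1.
  by move=> /andP[z0 /ltW hz]; rewrite -cabs_gt0 z0 mulrC -ler_pdivlMr ?exprn_gt0 // mul1r.
split; exists (2 ^+ 16)^-1; split=> // z /small[z0 hz].
  exact: g_fun_two_n_fun.
exact: n_fun_three_g_fun.
Qed.
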